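(* Let $\overline{X}=(X_0,X_1)$ be a compatible (quasi-)Banach couple and let $0<\theta_0<\theta_1<1$. Let $E_0,E_1,F_0,F_1$ be r.i. spaces and let $a_0,a_1,b_0,b_1\in SV$ be such that $\|b_0\|_{\widetilde{E}_0(1,\infty)}<\infty$ and $\|b_1\|_{\widetilde{E}_1(0,1)}<\infty$. Put $$\rho(u)=u^{\theta_1-\theta_0}\frac{a_0(u)\|b_0\|_{\widetilde{E}_0(u,\infty)}}{a_1(u)\|b_1\|_{\widetilde{E}_1(0,u)}},\qquad u>0.$$ Then, for every $f\in\overline{X}^{\mathcal L}_{\theta_0,b_0,E_0,a_0,F_0}+\overline{X}^{\mathcal R}_{\theta_1,b_1,E_1,a_1,F_1}$ and every $u>0$, $$\begin{aligned}K\big(\rho(u),f;\overline{X}^{\mathcal L}_{\theta_0,b_0,E_0,a_0,F_0},\overline{X}^{\mathcal R}_{\theta_1,b_1,E_1,a_1,F_1}\big)\sim{}&\Big\|b_0(t)\|s^{-\theta_0}a_0(s)K(s,f)\|_{\widetilde{F}_0(0,t)}\Big\|_{\widetilde{E}_0(0,u)}\\&+\|b_0\|_{\widetilde{E}_0(u,\infty)}\,\|t^{-\theta_0}a_0(t)K(t,f)\|_{\widetilde{F}_0(0,u)}\\&+\rho(u)\,\|b_1\|_{\widetilde{E}_1(0,u)}\,\|t^{-\theta_1}a_1(t)K(t,f)\|_{\widetilde{F}_1(u,\infty)}\\&+\rho(u)\Big\|b_1(t)\|s^{-\theta_1}a_1(s)K(s,f)\|_{\widetilde{F}_1(t,\infty)}\Big\|_{\widetilde{E}_1(u,\infty)},\end{aligned}$$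 with equivalence constants independent of $f$ and $u$.
   Context: R.i. spaces: an ''r.i. space'' $E$ is a rearrangement invariant Banach function space on $(0,\infty)$ (Lebesgue measure) with the Fatou property. $\widetilde{E}$ denotes the corresponding r.i. space with respect to the measure $dt/t$ on $(0,\infty)$: if $E=\mathcal F(L_1,L_\infty)$ for an interpolation functor $\mathcal F$, then $\widetilde{E}=\mathcal F(\widetilde L_1,L_\infty)$ with $\widetilde L_1=L_1((0,\infty),dt/t)$; concretely $\|f\|_{\widetilde E}=\|f^\star\|_E$, where $f^\star$ is the non-increasing rearrangement of $f$ with respect to $dt/t$. For an interval $I\subset(0,\infty)$, $\|f\|_{\widetilde E(I)}=\|f\chi_I\|_{\widetilde E}$. Slowly varying functions: a positive (finite) measurable function $b$ on $(0,\infty)$ belongs to $SV$ if for every $\varepsilon>0$, $t^{\varepsilon}b(t)$ is equivalent to a non-decreasing function and $t^{-\varepsilon}b(t)$ is equivalent to a non-increasing function on $(0,\infty)$. For a compatible (quasi-)Banach couple $(Y_0,Y_1)$, $K(t,f;Y_0,Y_1)=\inf\{\|f_0\|_{Y_0}+t\|f_1\|_{Y_1}: f=f_0+f_1,\ f_i\in Y_i\}$; write $K(t,f)=K(t,f;X_0,X_1)$. The space $\overline X^{\mathcal R}_{\theta,b,E,a,F}$ (resp. $\overline X^{\mathcal L}_{\theta,b,E,a,F}$) consists of all $f\in X_0+X_1$ with finite (quasi-)norm $\big\|b(t)\|s^{-\theta}a(s)K(s,f)\|_{\widetilde F(t,\infty)}\big\|_{\widetilde E}$ (resp. $\big\|b(t)\|s^{-\theta}a(s)K(s,f)\|_{\widetilde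 F(0,t)}\big\|_{\widetilde E}$). In nested norms the inner norm is taken in $s$ and the outer one in $t$. $A\sim B$ means $A\le cB$ and $B\le cA$ for some constant $c>0$. *)

(* Defs.v *)
From HB Require Import structures.
From mathcomp Require Import all_boot all_order all_algebra.
From mathcomp Require Import all_classical all_reals all_analysis.
From mathcomp Require Import measurable_realfun.

Set Implicit Arguments.
Unset Strict Implicit.
Unset Printing Implicit Defensive.

Import Order.TTheory GRing.Theory Num.Theory.
Import numFieldNormedType.Exports.

Local Open Scope classical_set_scope.
Local Open Scope ring_scope.
Local Open Scope ereal_scope.

(** * Rearrangement invariant spaces on (0, +oo)

    Functions on (0, +oo) are represented by functions on the whole of [R],
    whose values outside of (0, +oo) play no role. *)

Section RISpaces.
Context {R : realType}.
Local Notation mu := (@lebesgue_measure R).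

Definition nneg_meas (f : R -> \bar R) : Prop :=
  measurable_fun (`]0%R, +oo[ : set R) f /\ (forall x, (0 < x)%R -> 0 <= f x).

Definition equimeasurable (f g : R -> \bar R) : Prop :=
  forall l : R, (0 <= l)%R ->
    mu [set x | (0 < x)%R /\ l%:E < f x] = mu [set x | (0 < x)%R /\ l%:E < g x].

End RISpaces.

(** An r.i. space is given by its function norm on the non-negative measurable
    functions (Bennett-Sharpley, "Interpolation of Operators", Chapters 1-2);
    the Fatou property is [ri_fatou]. *)
Record riSpace (R : realType) := RISpace {
  rinorm :> (R -> \bar R) -> \bar R ;
  ri_ge0 : forall f, nneg_meas f -> 0 <= rinorm f ;
  ri_eq0 : forall f, nneg_meas f ->
    (rinorm f = 0 <->
     {ae lebesgue_measure, forall x : R, (0 < x)%R -> f x = 0}) ;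
  ri_scale : forall (k : R) f, (0 <= k)%R -> nneg_meas f ->
    rinorm (fun x => k%:E * f x) = k%:E * rinorm f ;
  ri_triangle : forall f g, nneg_meas f -> nneg_meas g ->
    rinorm (fun x => f x + g x) <= rinorm f + rinorm g ;
  ri_lattice : forall f g, nneg_meas f -> nneg_meas g ->
    {ae lebesgue_measure, forall x : R, (0 < x)%R -> f x <= g x} ->
    rinorm f <= rinorm g ;
  ri_fatou : forall (f_ : nat -> R -> \bar R) f,
    (forall n, nneg_meas (f_ n)) -> nneg_meas f ->
    {ae lebesgue_measure, forall x : R, (0 < x)%R ->
       nondecreasing_seq (fun n => f_ n x) /\
       (f_ n x @[n --> \oo] --> f x)} ->
    rinorm (f_ n) @[n --> \oo] --> rinorm f ;
  ri_indic : forall A : set R, measurable A -> A `<=` `]0%R, +oo[ ->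
    lebesgue_measure A < +oo -> rinorm (fun x => (\1_A x)%:E) < +oo ;
  ri_local_L1 : forall A : set R, measurable A -> A `<=` `]0%R, +oo[ ->
    lebesgue_measure A < +oo ->
    exists C : R, forall f, nneg_meas f ->
      \int[lebesgue_measure]_(x in A) f x <= C%:E * rinorm f ;
  ri_invariant : forall f g, nneg_meas f -> nneg_meas g ->
    equimeasurable f g -> rinorm f = rinorm g
}.

Section TildeSpaces.
Context {R : realType}.

(** The measure [dt/t] on (0, +oo). *)
Definition dtt (A : set R) : \bar R :=
  \int[lebesgue_measure]_(x in A `&` `]0%R, +oo[) (x^-1)%:E.

(** Non-increasing rearrangement with respect to [dt/t]. *)
Definition rearr (f : R -> \bar R) (t : R) : \bar R :=
  ereal_inf [set l%:E | l in
    [set l : R | (0 <= l)%R /\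
                 dtt [set x | (0 < x)%R /\ l%:E < `|f x|] <= t%:E]].

Definition tnorm (E : riSpace R) (f : R -> \bar R) : \bar R := E (rearr f).

(** [f \_ I] is [f] times the characteristic function of [I]. *)
Definition tnorm_on (E : riSpace R) (I : set R) (f : R -> \bar R) : \bar R :=
  tnorm E (f \_ I).

End TildeSpaces.

(** * Slowly varying functions *)

Section SlowlyVarying.
Context {R : realType}.

Definition equiv_on_pos (f g : R -> R) : Prop :=
  exists2 c : R, (0 < c)%R &
    forall t, (0 < t)%R -> (f t <= c * g t)%R /\ (g t <= c * f t)%R.

Definition SV (b : R -> R) : Prop :=
  [/\ measurable_fun (`]0%R, +oo[ : set R) b,
      (forall t, (0 < t)%R -> (0 < b t)%R) &
      forall e : R, (0 < e)%R ->
        (exists2 g : R -> R,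
           (forall x y, (0 < x)%R -> (x <= y)%R -> (g x <= g y)%R) &
           equiv_on_pos (fun t => t `^ e * b t)%R g) /\
        (exists2 g : R -> R,
           (forall x y, (0 < x)%R -> (x <= y)%R -> (g y <= g x)%R) &
           equiv_on_pos (fun t => t `^ (- e) * b t)%R g)].

End SlowlyVarying.

(** * Compatible couples and the K-functional

    Scalars are real. This covers complex spaces as well, since nothing below
    changes when a complex space is regarded as a real one. *)

Record nspace (V : Type) (R : realType) := NSpace {
  carrier : set V ;
  nnorm : V -> \bar R  (* only meaningful on [carrier] *)
}.

Section Couples.
Context {R : realType} {V : topologicalLmodType R}.

Definition ncauchy (Y : nspace V R) (x_ : nat -> V) : Prop :=
  forall e : R, (0 < e)%R -> exists N, forall m n, (N <= m)%N -> (N <= n)%N ->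
    nnorm Y (x_ m - x_ n)%R < e%:E.

Definition nconv (Y : nspace V R) (x_ : nat -> V) (x : V) : Prop :=
  forall e : R, (0 < e)%R -> exists N, forall n, (N <= n)%N ->
    nnorm Y (x_ n - x)%R < e%:E.

Record quasi_banach (Y : nspace V R) : Prop := QuasiBanach {
  qb_0 : carrier Y 0%R ;
  qb_lin : forall (k : R) x y, carrier Y x -> carrier Y y ->
    carrier Y (k *: x + y)%R ;
  qb_fin : forall x, carrier Y x -> 0 <= nnorm Y x < +oo ;
  qb_eq0 : forall x, carrier Y x -> nnorm Y x = 0 -> x = 0%R ;
  qb_scale : forall (k : R) x, carrier Y x ->
    nnorm Y (k *: x)%R = `|k|%:E * nnorm Y x ;
  qb_quasi_triangle : exists C : R, forall x y, carrier Y x -> carrier Y y ->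
    nnorm Y (x + y)%R <= C%:E * (nnorm Y x + nnorm Y y) ;
  qb_complete : forall x_ : nat -> V, (forall n, carrier Y (x_ n)) ->
    ncauchy Y x_ ->
    exists2 x, carrier Y x & nconv Y x_ x
}.

Definition continuously_embedded (Y : nspace V R) : Prop :=
  forall U : set V, nbhs (0%R : V) U ->
    exists2 e : R, (0 < e)%R & forall x, carrier Y x -> nnorm Y x < e%:E -> U x.

Definition compatible_couple (X0 X1 : nspace V R) : Prop :=
  [/\ hausdorff_space V,
      quasi_banach X0 /\ continuously_embedded X0 &
      quasi_banach X1 /\ continuously_embedded X1].

Definition sum_space (Y0 Y1 : nspace V R) : set V :=
  [set f | exists f0 f1, [/\ carrier Y0 f0, carrier Y1 f1 & f = (f0 + f1)%R]].

Definition Kfun (Y0 Y1 : nspace V R) (t : R) (f : V) : \bar R :=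
  ereal_inf [set z | exists f0 f1,
    [/\ carrier Y0 f0, carrier Y1 f1, f = (f0 + f1)%R &
        z = nnorm Y0 f0 + t%:E * nnorm Y1 f1]].

(** The function [s |-> s^(-theta) a(s) K(s, f; X0, X1)]. *)
Definition wK (X0 X1 : nspace V R) (theta : R) (a : R -> R) (f : V) (s : R) :
    \bar R :=
  (s `^ (- theta) * a s)%:E * Kfun X0 X1 s f.

Definition normR (X0 X1 : nspace V R) (theta : R) (b : R -> R) (E : riSpace R)
    (a : R -> R) (F : riSpace R) (f : V) : \bar R :=
  tnorm E (fun t => (b t)%:E * tnorm_on F `]t, +oo[ (wK X0 X1 theta a f)).

Definition normL (X0 X1 : nspace V R) (theta : R) (b : R -> R) (E : riSpace R)
    (a : R -> R) (F : riSpace R) (f : V) : \bar R :=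
  tnorm E (fun t => (b t)%:E * tnorm_on F `]0%R, t[ (wK X0 X1 theta a f)).

Definition spaceR (X0 X1 : nspace V R) (theta : R) (b : R -> R) (E : riSpace R)
    (a : R -> R) (F : riSpace R) : nspace V R :=
  NSpace [set f | sum_space X0 X1 f /\ normR X0 X1 theta b E a F f < +oo]
         (normR X0 X1 theta b E a F).

Definition spaceL (X0 X1 : nspace V R) (theta : R) (b : R -> R) (E : riSpace R)
    (a : R -> R) (F : riSpace R) : nspace V R :=
  NSpace [set f | sum_space X0 X1 f /\ normL X0 X1 theta b E a F f < +oo]
         (normL X0 X1 theta b E a F).

End Couples.

(* Main.v *)
Require Import Defs.
From HB Require Import structures.
From mathcomp Require Import all_boot all_order all_algebra.
From mathcomp Require Import all_classical all_reals all_analysis.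
From mathcomp Require Import measurable_realfun.
From mathcomp Require Import ring lra zify.

Set Implicit Arguments.
Unset Strict Implicit.
Unset Printing Implicit Defensive.

Import Order.TTheory GRing.Theory Num.Theory.
Import numFieldNormedType.Exports.

Local Open Scope classical_set_scope.
Local Open Scope ring_scope.
Local Open Scope ereal_scope.

(** Everything rests on three facts about the norm of an r.i. space taken with
    respect to dt/t.

    - It is a lattice norm invariant under dilations. There is a map from
      (0, +oo) to itself that carries Lebesgue measure to dt/t ([dtt_mapE]), so
      the rearrangement of f and the composition of f with that map are
      equimeasurable, and the norm of f is the norm of the composition
      ([tnormE]). The triangle inequality, the lattice and Fatou properties
      are thereby inherited; dilation invariance is that of dt/t.
    - If a weight W grows or decays at least like a power, its norm on the
      half-line on which it is small is at most a constant times W(u), where u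
      is the endpoint ([tnorm_growth_le]): by dilation the comparison is with
      the norm of a power on (1, +oo) or (0, 1), finite by dyadic summation.
    - Conversely W(u) is at most a constant times the norm of W on either side
      of u ([tnorm_growth_ge]), because W is comparable to W(u) on a dyadic
      interval next to u. Since the constants depend only on the growth of W,
      this applies to W multiplied by K(., f), uniformly in f.

    A slowly varying function grows slower than every power, and so do the
    tails of b0 and b1 ([pweight_tail]), which is why all weights that occur
    have the power growth dictated by theta0 and theta1.

    Upper bound. Choose f = f0 + f1 nearly optimal for K(u, f). Then K(s, f0)
    is controlled by K(s, f) for s < u and by K(u, f) for s > u, and K(s, f1)
    by K(s, f) for s > u and by (s/u) K(u, f) for s < u
    ([Kfun_decomposition]). The part of each norm beyond u is a norm of a power
    times K(u, f), which the part before u absorbs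
    ([decomposition_outer_le]). So the norm of f0 is bounded by the first two
    terms of the formula and that of f1 by the last two divided by rho(u).

    Lower bound. The four terms are subadditive in f up to a constant
    ([split_norm_add]), so let f = g0 + g1 and estimate them for g0 and g1
    separately. The first two terms at g0 and the last two at g1 are parts of
    the corresponding norms ([split_norm_le_outer]). For the other combinations,
    finiteness of the norm of g0 forces the pointwise bound
    K(s, g0) <= C |g0| / (s^(-theta0) a0(s) B0(s)), where B0(s) is the tail of
    b0 ([quasiconcave_bound]); inserted in the last two terms it leaves norms
    of decaying powers, evaluated at u ([opposite_le]), and rho is exactly the
    ratio that makes the outcome a multiple of |g0|. The roles of g0 and g1
    are symmetric. To prove the two halves at once, everything is stated for a
    direction d: the half-line is (u, +oo) if d is true, (0, u) otherwise. *)

(** * The measure dt/t as an image of Lebesgue measure *)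

Lemma measurable_preimage_expR (R : realType) (A : set R) :
  measurable A -> measurable (@expR R @^-1` A : set R).
Proof.
by move=> mA; rewrite -[X in measurable X]setTI; exact: measurable_expR.
Qed.

Lemma measurable_inv_pos (R : realType) :
  measurable_fun (`]0%R, +oo[%classic : set R) (@GRing.inv R).
Proof.
apply: subspace_continuous_measurable_fun => //.
apply: continuous_in_subspaceT => x; rewrite inE/= in_itv/= andbT => x0.
by apply: continuousV; [rewrite gt_eqF|exact: cvg_id].
Qed.

Section log_measure.
Context {R : realType}.
Local Notation mu := (@lebesgue_measure R).

Let inv_meas : measurable_fun (`]0%R, +oo[ : set R) (fun x : R => (x^-1)%:E).
Proof. by apply/measurable_EFinP; exact: measurable_inv_pos. Qed.

Let inv_ge0 (x : R) : `]0%R, +oo[%classic x -> 0 <= (x^-1)%:E.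
Proof. by rewrite /= in_itv/= andbT => x0; rewrite lee_fin invr_ge0 ltW. Qed.

Let lnS (A : set R) : measurable A -> measurable (@ln R @^-1` A : set R).
Proof. by move=> mA; rewrite -[X in measurable X]setTI; exact: measurable_ln. Qed.

(** The image of dt/t under the logarithm, to be recognized as Lebesgue measure
    on the whole line. *)
Definition log_dtt (A : set (measurableTypeR R)) : \bar R := dtt (@ln R @^-1` A).

Let log_dtt0 : log_dtt set0 = 0.
Proof. by rewrite /log_dtt /dtt preimage_set0 set0I integral_set0. Qed.

Let log_dtt_ge0 A : 0 <= log_dtt A.
Proof. by apply: integral_ge0 => x [_]; exact: inv_ge0. Qed.

Let log_dtt_sigma_additive : semi_sigma_additive log_dtt.
Proof.
move=> /= F mF tF mUF; rewrite /log_dtt /dtt; apply: cvg_toP.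
  apply: ereal_nondecreasing_is_cvgn => m n mn.
  by apply: lee_sum_nneg_natr => // k _ _; exact: log_dtt_ge0.
rewrite preimage_bigcup setI_bigcupl ge0_integral_bigcup//=.
- move=> k; apply: (@measurableI _ (measurableTypeR R)); last exact: measurable_itv.
  by have H := lnS (mF k); exact: H.
- apply: (measurable_funS _ _ inv_meas); first exact: measurable_itv.
  by move=> x [k _ []].
- by move=> x [k _ [_]]; exact: inv_ge0.
- move=> i j _ _ [x [[/= Fi _] [Fj _]]]; apply: tF => //.
  by exists (ln x).
Qed.

HB.instance Definition _ := isMeasure.Build _ _ _ log_dtt
  log_dtt0 log_dtt_ge0 log_dtt_sigma_additive.

Lemma integral_inv (a b : R) : (0 < a)%R -> (a <= b)%R ->
  \int[mu]_(x in `]a, b]) (x^-1)%:E = (ln b - ln a)%:E.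
Proof.
move=> a0; rewrite le_eqVlt => /predU1P[->|ab].
  by rewrite set_itvoc0 integral_set0 subrr.
have xp x : x \in `[a, b] -> (0 < x)%R.
  by rewrite in_itv/= => /andP[ax _]; exact: lt_le_trans ax.
rewrite integral_itv_obnd_cbnd; last first.
  apply: measurable_funS inv_meas => // x /=; rewrite !in_itv/= andbT.
  by move=> /andP[ax _]; exact: lt_trans ax.
rewrite (@continuous_FTC2 _ (fun x => x^-1)%R (@ln R)) //.
- apply: continuous_in_subspaceT => x; rewrite inE/= => /xp x0.
  by apply: continuousV; [rewrite gt_eqF|exact: cvg_id].
- split.
  + move=> x /=; rewrite in_itv/= => /andP[ax _].
    have x0 := lt_trans a0 ax.
    by have [] := is_derive1_ln x0.
  + by apply: cvg_at_right_filter; exact: continuous_ln.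
  + by apply: cvg_at_left_filter; apply: continuous_ln; exact: lt_trans ab.
- move=> x; rewrite in_itv/= => /andP[ax _].
  have x0 := lt_trans a0 ax.
  by rewrite derive1E; apply: derive_val; exact: is_derive1_ln.
Qed.

(** In logarithmic scale dt/t is Lebesgue measure: both give b - a to the
    interval ]a, b], hence agree on all Borel sets. *)
Lemma dttE (A : set R) : measurable A -> dtt A = mu (@expR R @^-1` A).
Proof.
move=> mA; have mE := measurable_preimage_expR mA.
rewrite [RHS](@lebesgue_measure_unique _ log_dtt)//=; last first.
  move=> _ [[a b]] _ <-.
  rewrite lebesgue_measure_itv/= lte_fin /log_dtt /dtt.
  have [ba|ab] := leP b a.
    rewrite set_itv_ge ?bnd_simp -?leNgt// preimage_set0 set0I
      ?integral_set0.
  rewrite (_ : _ `&` _ = `]expR a, expR b]%classic).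
    rewrite integral_inv ?expR_gt0 ?ler_expR ?ltW//.
    by rewrite !expRK.
  apply/seteqP; split => x /=; rewrite !in_itv/= ?andbT.
    move=> [/andP[ax xb] x0]; apply/andP; split.
      by rewrite -(lnK x0) ltr_expR.
    by rewrite -(lnK x0) ler_expR.
  move=> /andP[ax xb]; have x0 : (0 < x)%R by apply: lt_trans ax; exact: expR_gt0.
  split=> //; apply/andP; split.
    by rewrite -ltr_expR lnK.
  by rewrite -ler_expR lnK.
rewrite /log_dtt /dtt; congr (integral _ _ _).
apply/seteqP; split => x /=; rewrite !in_itv/= ?andbT => -[Ax x0]; split => //.
  by rewrite lnK.
by rewrite lnK in Ax.
Qed.

End log_measure.

Section unroll.
Context {R : realType}.
Local Notation mu := (@lebesgue_measure R).

Lemma lebesgue_measure_shift (c : R) (A : set R) : measurable A ->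
  mu ((fun x => x + c)%R @^-1` A) = mu A.
Proof.
move=> mA.
have mD : measurable_fun setT (fun x : measurableTypeR R => (x + c)%R : measurableTypeR R).
  by apply: measurable_funD => //; exact: measurable_cst.
pose m := pushforward mu (fun x : measurableTypeR R => (x + c)%R : measurableTypeR R).
rewrite [RHS](@lebesgue_measure_unique _ m)//= => _ [[a b]] _ <-.
rewrite /m /pushforward (_ : _ @^-1` _ = `]a - c, b - c]%classic)%R; last first.
  by apply/seteqP; split => x /=; rewrite !in_itv/= ltrBlDr lerBrDr.
rewrite !lebesgue_measure_itv/= !lte_fin ltrBlDr subrK.
by case: ifP => // _; rewrite -!EFinD; congr (_%:E); ring.
Qed.

(** A bijection from the natural numbers to the integers; it orders the unit
    intervals of the line along those of the half-line. *)
Definition zigzag (n : nat) : int := if odd n then Negz n./2 else Posz n./2.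

Lemma zigzag_inj : injective zigzag.
Proof. move=> m n; rewrite /zigzag; case: ifP; case: ifP => //= om on []; lia. Qed.

Lemma zigzag_surj (z : int) : exists n, zigzag n = z.
Proof.
case: z => n; [exists n.*2|exists n.*2.+1]; rewrite /zigzag/= odd_double//=.
  by rewrite doubleK.
by rewrite uphalf_double.
Qed.

(** For x > 0, the n for which x belongs to the interval ]n, n + 1]. *)
Definition unit_index (x : R) : nat := (absz (Num.ceil x)).-1.

(** An interval exchange from the half-line onto the line: it translates
    ]n, n + 1] onto ]z, z + 1] with z = zigzag n. *)
Definition unroll (x : R) : R :=
  (x + ((zigzag (unit_index x))%:~R - (unit_index x)%:R))%R.

Let piece (n : nat) : set R := `]n%:R%R, (n%:R + 1)%R]%classic.

Let pieceP n x : piece n x -> unit_index x = n.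
Proof.
rewrite /piece/= in_itv/= => nx; rewrite /unit_index (@ceil_def _ x (Posz n.+1))//.
by rewrite intS addrAC subrr add0r addrC rmorphD.
Qed.

Let unroll_piece (n : nat) (B : set R) :
  piece n `&` unroll @^-1` B = (fun x => x + ((zigzag n)%:~R - n%:R))%R @^-1`
    (B `&` `]((zigzag n)%:~R)%R, ((zigzag n)%:~R + 1)%R]%classic).
Proof.
apply/seteqP; split => x /=.
  move=> [px]; rewrite /unroll (pieceP px) => ux; split => //.
  by move: px; rewrite /piece/= !in_itv/= => /andP[? ?]; apply/andP; split; lra.
move=> [Bx]; rewrite in_itv/= => /andP[? ?].
have px : piece n x by rewrite /piece/= in_itv/=; apply/andP; split; lra.
by split => //; rewrite /unroll (pieceP px).
Qed.

Let piece_cover : `]0%R, +oo[%classic = \bigcup_n piece n.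
Proof.
apply/seteqP; split => x /=; rewrite in_itv/= ?andbT.
  move=> x0; exists (unit_index x) => //; rewrite /piece/= in_itv/=.
  have c0 : (0 < Num.ceil x)%R by rewrite ceil_gt0.
  have -> : (unit_index x)%:R = ((Num.ceil x)%:~R - 1 :> R)%R.
    rewrite /unit_index; case: (Num.ceil x) c0 => // -[//|m] _ /=.
    by rewrite intS rmorphD/= addrAC subrr add0r.
  by rewrite subrK -[X in (X < _)%R](rmorphB _ _ 1%R) ceil_itv.
move=> [n _]; rewrite /piece/= in_itv/= => /andP[nx _].
by apply: le_lt_trans nx; exact: ler0n.
Qed.

Let piece_meas (n : nat) (B : set R) : measurable B ->
  measurable (piece n `&` unroll @^-1` B).
Proof.
move=> mB; rewrite unroll_piece -[X in measurable X]setTI.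
apply: (measurable_funD (f:=id) (g:=cst ((zigzag n)%:~R - n%:R)%R)) => //.
by apply: measurableI => //; exact: measurable_itv.
Qed.

Lemma measurable_unroll : measurable_fun (`]0%R, +oo[ : set R) unroll.
Proof.
move=> _ B mB; rewrite piece_cover setI_bigcupl.
by apply: bigcup_measurable => n _; exact: piece_meas.
Qed.

(** Each unit interval is translated onto another one, and each unit interval of
    the line is hit exactly once. *)
Lemma unrollE (B : set R) : measurable B ->
  mu (`]0%R, +oo[ `&` unroll @^-1` B) = mu B.
Proof.
move=> mB; rewrite piece_cover setI_bigcupl measure_semi_bigcup; first last.
- by apply: bigcup_measurable => n _; exact: piece_meas.
- move=> i j _ _ [x [[/pieceP xi _] [/pieceP xj _]]].
  by rewrite -xi -xj.
- by move=> n; exact: piece_meas.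
pose Q (n : nat) : set R :=
  B `&` `]((zigzag n)%:~R)%R, ((zigzag n)%:~R + 1)%R]%classic.
have mQ n : measurable (Q n) by apply: measurableI => //; exact: measurable_itv.
transitivity (\sum_(i <oo) mu (Q i)).
  by apply: eq_eseriesr => n _; rewrite unroll_piece; exact: lebesgue_measure_shift (mQ n).
rewrite -measure_semi_bigcup//; last by apply: bigcup_measurable => n _; exact: mQ.
  congr (mu _); apply/seteqP; split => [x [n _ []//]|x Bx].
  have [n nz] := zigzag_surj (Num.ceil (x : R) - 1)%R.
  exists n => //; split=> //=; rewrite nz in_itv/= rmorphB/= subrK.
  by rewrite -[X in (X < _)%R](rmorphB _ _ 1%R) ceil_itv.
move=> i j _ _ [x [[_ /=+] [_ /=]]]; rewrite !in_itv/= => ix jx.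
have cx k : ((zigzag k)%:~R < (x : R) <= (zigzag k)%:~R + 1)%R ->
    Num.ceil (x : R) = (zigzag k + 1)%R.
  by move=> kx; apply: ceil_def; rewrite addrK rmorphD.
by apply: zigzag_inj; apply: (@addIr _ 1%R); rewrite -(cx i ix) -(cx j jx).
Qed.

(** A measure preserving map from Lebesgue measure on (0, +oo) to dt/t. No
    monotone map will do, as dt/t is infinite both near 0 and near +oo; hence
    the interval exchange before the exponential. *)
Definition dtt_map (x : R) : R := expR (unroll x).

Lemma dtt_map_gt0 x : (0 < dtt_map x)%R. Proof. exact: expR_gt0. Qed.

Lemma measurable_dtt_map : measurable_fun (`]0%R, +oo[ : set R) dtt_map.
Proof. exact: (measurableT_comp (@measurable_expR R) measurable_unroll). Qed.

Lemma dtt_mapE (A : set R) : measurable A ->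
  mu [set x | (0 < x)%R /\ A (dtt_map x)] = dtt A.
Proof.
move=> mA; have mE := measurable_preimage_expR mA.
rewrite dttE// -(unrollE mE).
by congr (mu _); apply/seteqP; split => x /=; rewrite in_itv/= andbT.
Qed.

End unroll.

(** * The norm of an r.i. space with respect to dt/t *)

Section tilde_norm.
Context {R : realType}.
Local Notation mu := (@lebesgue_measure R).
Local Notation pos := (`]0%R, +oo[%classic : set R).
Implicit Types (f g : R -> \bar R) (E : riSpace R).

Lemma nneg_meas_nd f : (forall x, (0 < x)%R -> 0 <= f x) ->
  (forall x y, (0 < x)%R -> (x <= y)%R -> f x <= f y) -> nneg_meas f.
Proof.
move=> f0 fnd; split => // mD.
apply: (measurability _ (ErealGenCInfty.measurableE R)) => // _ [_ [r ->] <-].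
apply: is_interval_measurable => s t /=; rewrite !in_itv/= !andbT.
move=> [s0 fs] [t0 ft] u /andP[su ut].
have u0 : (0 < u)%R by exact: lt_le_trans su.
by split; [rewrite in_itv/= u0|rewrite in_itv/= andbT (le_trans fs)// fnd].
Qed.

Lemma nneg_meas_ni f : (forall x, (0 < x)%R -> 0 <= f x) ->
  (forall x y, (0 < x)%R -> (x <= y)%R -> f y <= f x) -> nneg_meas f.
Proof.
move=> f0 fnd; split => // mD.
apply: (measurability _ (ErealGenCInfty.measurableE R)) => // _ [_ [r ->] <-].
apply: is_interval_measurable => s t /=; rewrite !in_itv/= !andbT.
move=> [s0 fs] [t0 ft] u /andP[su ut].
have u0 : (0 < u)%R by exact: lt_le_trans su.
by split; [rewrite in_itv/= u0|rewrite in_itv/= andbT (le_trans ft)// fnd].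
Qed.

Lemma nneg_measM f g : nneg_meas f -> nneg_meas g ->
  nneg_meas (fun x => f x * g x).
Proof.
move=> [mf f0] [mg g0]; split; first exact: emeasurable_funM.
by move=> x x0; rewrite mule_ge0 ?f0 ?g0.
Qed.

Lemma nneg_measD f g : nneg_meas f -> nneg_meas g ->
  nneg_meas (fun x => f x + g x).
Proof.
move=> [mf f0] [mg g0]; split; first exact: emeasurable_funD.
by move=> x x0; rewrite adde_ge0 ?f0 ?g0.
Qed.

Lemma nneg_meas_cst (k : R) : (0 <= k)%R -> @nneg_meas R (fun=> k%:E).
Proof. by move=> k0; split => //; exact: measurable_cst. Qed.

Lemma nneg_meas_EFin (w : R -> R) : measurable_fun pos w ->
  (forall x, (0 < x)%R -> (0 <= w x)%R) -> nneg_meas (EFin \o w).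
Proof. by move=> mw w0; split => //; exact/measurable_EFinP. Qed.

Lemma nneg_meas_restrict (i : interval R) f :
  nneg_meas f -> nneg_meas (f \_ [set` i]).
Proof.
move=> [mf f0]; split; last first.
  by move=> x x0; rewrite patchE; case: ifP => // _; exact: f0.
apply/measurable_restrict; [exact: measurable_itv|exact: measurable_itv|].
by apply: (measurable_funS _ _ mf); [exact: measurable_itv|move=> ? []].
Qed.

Local Notation D f l := [set x | (0 < x)%R /\ l%:E < `|f x|].

Let measurable_superlevel f l : nneg_meas f -> measurable (D f l).
Proof.
move=> [mf f0]; rewrite (_ : mkset _ = pos `&` [set x | l%:E < f x]).
  by apply: emeasurable_fun_o_infty mf _; exact: measurable_itv.
apply/seteqP; split => x [] /=; rewrite in_itv/= ?andbT => x0 lf; split => //.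
  by rewrite gee0_abs ?f0// in lf.
by rewrite gee0_abs ?f0.
Qed.

Lemma dtt_le (A B : set R) : measurable A -> measurable B -> A `<=` B ->
  dtt A <= dtt B.
Proof.
move=> mA mB AB; rewrite !dttE//; apply: le_measure; rewrite ?inE.
- exact: measurable_preimage_expR.
- exact: measurable_preimage_expR.
- by move=> x /=; exact: AB.
Qed.

(** The distribution function of f is continuous from the right, by continuity
    of the measure along the increasing sets on which f > l + 1/n. *)
Let dtt_right f (l : R) (t : R) : nneg_meas f -> t%:E < dtt (D f l) ->
  exists2 l' : R, (l < l')%R & t%:E < dtt (D f l').
Proof.
move=> nf; have mD n := measurable_superlevel (l + n.+1%:R^-1)%R nf.
pose F n : set R := @expR R @^-1` D f (l + n.+1%:R^-1)%R.
have mF n : measurable (F n) by exact: measurable_preimage_expR.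
have UF : \bigcup_n F n = @expR R @^-1` D f l.
  apply/seteqP; split => [x [n _ [/= x0 lx]]|x [/= x0 lx]].
    split => //; apply: lt_trans lx.
    by rewrite lte_fin ltrDl.
  have [n ln] : exists n : nat, (l + n.+1%:R^-1)%:E < `|f (expR x)|.
    case: (`|f (expR x)|) lx => [r| |//]; last by exists 0%N; rewrite ltry.
    rewrite lte_fin -subr_gt0 => rl.
    have [n _ /(_ n)/= nr] := near_infty_natSinv_lt (PosNum rl).
    by exists n; rewrite lte_fin -ltrBrDl nr//=.
  by exists n.
have ndF : nondecreasing_seq F.
  move=> m n mn; apply/subsetPset => x [/= x0 mx]; split => //.
  apply: le_lt_trans mx; rewrite lee_fin lerD2l lef_pV2 ?posrE//.
  by rewrite ler_nat ltnS.
have := @nondecreasing_cvg_mu _ _ _ mu F mF.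
rewrite UF => /(_ (measurable_preimage_expR (measurable_superlevel l nf)) ndF) cF.
rewrite dttE; last exact: measurable_superlevel.
move=> tD.
have [N tN] : exists N, t%:E < mu (F N).
  apply: contrapT => /forallNP Ft; move: tD; rewrite ltNge => /negP; apply.
  rewrite -(cvg_lim _ cF)//; apply: lime_le; first by apply/cvg_ex; eexists; exact: cF.
  by apply: nearW => n; rewrite leNgt; apply/negP; exact: Ft.
exists (l + N.+1%:R^-1)%R; first by rewrite ltrDl.
by rewrite dttE.
Qed.

(** The rearrangement is the generalized inverse of the distribution function;
    strict inequalities correspond by right-continuity. *)
Lemma rearr_gt f (l t : R) : nneg_meas f -> (0 <= l)%R ->
  (l%:E < rearr f t) = (t%:E < dtt [set x | (0 < x)%R /\ l%:E < f x]).
Proof.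
move=> nf l0.
have -> : [set x | (0 < x)%R /\ l%:E < f x] = D f l.
  case: nf => mf f0.
  apply/seteqP; split => x [] /= x0 lf; split => //.
    by rewrite gee0_abs ?f0.
  by rewrite gee0_abs ?f0// in lf.
apply/idP/idP => [|tD].
  apply: contraTT; rewrite -!leNgt => Dt.
  by apply: ereal_inf_lbound; exists l.
have [l' ll' tD'] := dtt_right nf tD.
apply: (@lt_le_trans _ _ l'%:E); first by rewrite lte_fin.
apply/ereal_infP => _ [m [m0 Dm] <-].
rewrite lee_fin leNgt; apply/negP => ml'.
have : t%:E < t%:E; last by rewrite ltxx.
apply: (lt_le_trans tD'); apply: le_trans Dm.
apply: dtt_le; [exact: measurable_superlevel|exact: measurable_superlevel|].
move=> x [x0 lx]; split => //; apply: lt_trans lx.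
by rewrite lte_fin.
Qed.

Lemma nneg_meas_rearr f : nneg_meas f -> nneg_meas (rearr f).
Proof.
move=> nf; apply: nneg_meas_ni.
  by move=> x _; apply/ereal_infP => _ [l [l0 _] <-]; rewrite lee_fin.
move=> x y _ xy; apply: ereal_inf_le_tmp => _ [l [l0 Dl] <-].
by exists l => //; split => //; rewrite (le_trans Dl)// lee_fin.
Qed.

Lemma nneg_meas_comp_dtt_map f : nneg_meas f -> nneg_meas (f \o @dtt_map R).
Proof.
move=> [mf f0]; split; last by move=> x _; apply: f0; exact: dtt_map_gt0.
apply: (measurable_comp _ _ mf (@measurable_dtt_map R)).
  exact: measurable_itv.
by move=> _ [x _ <-] /=; rewrite in_itv/= dtt_map_gt0.
Qed.

(** The distribution function of the rearrangement, at level l, is the length of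
    the interval ]0, m[ where m is the dt/t-measure of the set f > l; this is
    also the value for the composition of f with the measure preserving map. *)
Lemma tnormE E f : nneg_meas f -> tnorm E f = E (f \o @dtt_map R).
Proof.
move=> nf; apply: ri_invariant.
- exact: nneg_meas_rearr.
- exact: nneg_meas_comp_dtt_map.
move=> l l0.
have mA : measurable [set x | (0 < x)%R /\ l%:E < f x].
  rewrite (_ : mkset _ = pos `&` [set x | l%:E < f x]).
    by case: nf => mf _; apply: emeasurable_fun_o_infty mf _; exact: measurable_itv.
  by apply/seteqP; split => x [] /=; rewrite in_itv/= andbT.
transitivity (dtt [set x | (0 < x)%R /\ l%:E < f x]); last first.
  rewrite -dtt_mapE//; congr (mu _); apply/seteqP; split => x [] /= x0.
    by move=> [].
  by move=> lf; split => //; split => //; exact: dtt_map_gt0.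
under eq_set => t do rewrite rearr_gt//.
have : 0 <= dtt [set x | (0 < x)%R /\ l%:E < f x] by rewrite dttE.
move: (dtt _) => m m0.
case: m m0 => [r| |//]; rewrite ?lee_fin => r0.
  rewrite (_ : mkset _ = `]0%R, r[%classic).
    rewrite lebesgue_measure_itv/= lte_fin.
    have [r0'|] := ltP 0%R r; first by rewrite oppr0 adde0.
    by move=> r0'; congr (_%:E); apply/eqP; rewrite eq_le r0 r0'.
  apply/seteqP; split => x /=; rewrite in_itv/= lte_fin.
    by move=> [-> ->].
  by move=> /andP[].
rewrite (_ : mkset _ = `]0%R, +oo[%classic).
  by rewrite (@lebesgue_measure_itv R) ltry sube0.
apply/seteqP; split => x /=; rewrite in_itv/= andbT ltry.
  by move=> [].
by [].
Qed.

Lemma tnorm_ge0 E f : nneg_meas f -> 0 <= tnorm E f.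
Proof. by move=> nf; apply: ri_ge0; exact: nneg_meas_rearr. Qed.

Let measurable_dtt_map_preimage (A : set R) : measurable A -> measurable [set x | (0 < x)%R /\ A (dtt_map x)].
Proof.
move=> mA; rewrite (_ : mkset _ = pos `&` @dtt_map R @^-1` A).
  by apply: measurable_dtt_map => //; exact: measurable_itv.
by apply/seteqP; split => x [] /=; rewrite in_itv/= andbT.
Qed.

Lemma dtt_set1 (u : R) : dtt [set u] = 0.
Proof.
have m1 : measurable [set u] by exact: measurable_set1.
rewrite dttE//; apply/eqP; rewrite eq_le measure_ge0 andbT.
rewrite -(lebesgue_measure_set1 (ln u)).
apply: le_measure; rewrite ?inE//.
  exact: measurable_preimage_expR.
by move=> x /= <-; rewrite expRK.
Qed.

(** The exceptional point serves to cut (0, +oo) into two open half-lines. *)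
Lemma tnorm_le_but (u : R) E f g : nneg_meas f -> nneg_meas g ->
  (forall x, (0 < x)%R -> x != u -> f x <= g x) -> tnorm E f <= tnorm E g.
Proof.
move=> nf ng fg; rewrite !tnormE//; apply: ri_lattice.
- exact: nneg_meas_comp_dtt_map.
- exact: nneg_meas_comp_dtt_map.
exists [set x | (0 < x)%R /\ [set u] (dtt_map x)]; split.
- by apply: measurable_dtt_map_preimage; exact: measurable_set1.
- rewrite dtt_mapE; last exact: measurable_set1.
  exact: dtt_set1.
move=> x /= nfg.
have x0 : (0 < x)%R by apply: contrapT => x0; apply: nfg => /x0.
split => //; apply/eqP; apply: contraPT nfg => xu nfg; apply: nfg => _.
by apply: fg => //; exact: dtt_map_gt0.
Qed.

Lemma tnorm_le E f g : nneg_meas f -> nneg_meas g ->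
  (forall x, (0 < x)%R -> f x <= g x) -> tnorm E f <= tnorm E g.
Proof. by move=> nf ng fg; apply: (@tnorm_le_but 0%R) => // x x0 _; exact: fg. Qed.

Lemma tnorm_equidistributed E f g :
  (forall l, dtt (D f l) = dtt (D g l)) -> tnorm E f = tnorm E g.
Proof.
move=> fg; suff e : rearr f = rearr g by rewrite /tnorm e.
apply/funext => t; rewrite /rearr.
suff -> : [set l : R | (0 <= l)%R /\ dtt (D f l) <= t%:E] =
          [set l : R | (0 <= l)%R /\ dtt (D g l) <= t%:E] by [].
by apply/seteqP; split => l /=; rewrite fg.
Qed.

Lemma tnorm_eq E f g : (forall x, (0 < x)%R -> f x = g x) ->
  tnorm E f = tnorm E g.
Proof.
move=> fg; apply: tnorm_equidistributed => l; congr (dtt _).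
by apply/seteqP; split => x /= [x0]; rewrite fg.
Qed.

Lemma tnorm_scale E (k : R) f : (0 <= k)%R -> nneg_meas f ->
  tnorm E (fun x => k%:E * f x) = k%:E * tnorm E f.
Proof.
move=> k0 nf; rewrite !tnormE//; last first.
  by apply: nneg_measM => //; exact: nneg_meas_cst.
by rewrite -ri_scale//; exact: nneg_meas_comp_dtt_map.
Qed.

Lemma tnorm_add E f g : nneg_meas f -> nneg_meas g ->
  tnorm E (fun x => f x + g x) <= tnorm E f + tnorm E g.
Proof.
move=> nf ng; rewrite !tnormE//; last exact: nneg_measD.
by apply: ri_triangle; exact: nneg_meas_comp_dtt_map.
Qed.

Lemma dtt_itv (a b : R) : (0 < a)%R -> (a < b)%R ->
  dtt `]a, b] = (ln b - ln a)%:E.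
Proof.
move=> a0 ab; have b0 := lt_trans a0 ab; rewrite dttE; last exact: measurable_itv.
rewrite (_ : _ @^-1` _ = `]ln a, ln b]%classic).
  by rewrite (@lebesgue_measure_itv R)/= lte_fin ltr_ln// ab.
have ax x : (a < expR x)%R = (ln a < x)%R by rewrite -{1}(lnK a0) ltr_expR.
have xb x : (expR x <= b)%R = (x <= ln b)%R by rewrite -{1}(lnK b0) ler_expR.
by apply/seteqP; split => x /=; rewrite !in_itv/= ax xb.
Qed.

Let nneg1 : @nneg_meas R (cst 1).
Proof. by apply: nneg_meas_cst; exact: ler01. Qed.

Lemma tnorm_indic_fin E (a b : R) : (0 < a)%R -> (a < b)%R ->
  tnorm_on E `]a, b] (cst 1) < +oo.
Proof.
move=> a0 ab; rewrite /tnorm_on tnormE; last first.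
  by apply: nneg_meas_restrict; exact: nneg1.
pose A : set R := [set x | (0 < x)%R /\ `]a, b]%classic (dtt_map x)].
have mA : measurable A by apply: measurable_dtt_map_preimage; exact: measurable_itv.
apply: (@le_lt_trans _ _ (E (fun x => (\1_A x)%:E))); last first.
  apply: ri_indic => //.
    by move=> x [x0 _]; rewrite /= in_itv/= x0.
  by rewrite dtt_mapE ?dtt_itv ?ltry//; exact: measurable_itv.
apply: ri_lattice.
- by apply: nneg_meas_comp_dtt_map; apply: nneg_meas_restrict; exact: nneg1.
- apply: nneg_meas_EFin; last by move=> x _; rewrite indicE.
  by apply: measurable_funTS; exact: measurable_indic.
apply: aeW => x x0 /=; rewrite patchE indicE.
case: ifPn => xab; last by rewrite lee_fin.
rewrite mem_set ?lexx//; split => //.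
by move: xab; rewrite inE.
Qed.

Lemma tnorm_gt0 E f (a b : R) : (0 < a)%R -> (a < b)%R -> nneg_meas f ->
  (forall x, (a < x)%R -> (x <= b)%R -> 0 < f x) -> 0 < tnorm E f.
Proof.
move=> a0 ab nf fab; rewrite lt_neqAle tnorm_ge0// andbT eq_sym; apply/eqP.
rewrite tnormE// => /(ri_eq0 _ (nneg_meas_comp_dtt_map nf))[N [mN N0 sN]].
have : 0 < mu N; last by rewrite N0 ltxx.
apply: (@lt_le_trans _ _ (dtt `]a, b])).
  by rewrite dtt_itv// lte_fin subr_gt0 ltr_ln// posrE (lt_trans a0).
rewrite -dtt_mapE; last exact: measurable_itv.
apply: le_measure; rewrite ?inE//.
  by apply: measurable_dtt_map_preimage; exact: measurable_itv.
move=> x /= [x0]; rewrite in_itv/= => /andP[ax xb]; apply: sN => /= /(_ x0).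
by apply/eqP; rewrite gt_eqF// fab.
Qed.

(** In logarithmic scale a dilation is a translation. *)
Lemma dtt_dil (c : R) (A : set R) : (0 < c)%R -> measurable A ->
  A `<=` [set x | 0 < x]%R ->
  dtt [set x | (0 < x)%R /\ A (c * x)%R] = dtt A.
Proof.
move=> c0 mA Apos.
have mA' : measurable [set x | (0 < x)%R /\ A (c * x)%R].
  rewrite (_ : mkset _ = pos `&` ( *%R c @^-1` A)); last first.
    by apply/seteqP; split => x [] /=; rewrite in_itv/= andbT.
  have mc : measurable_fun pos ( *%R c) by exact: mulrl_measurable.
  by apply: mc => //; exact: measurable_itv.
rewrite !dttE// -[RHS](lebesgue_measure_shift (ln c)); last exact: measurable_preimage_expR.
congr (mu _); apply/seteqP; split => x /=;
  have -> : expR (x + ln c) = (c * expR x)%R by rewrite expRD lnK// mulrC.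
  by move=> [].
by move=> Ax; split => //; exact: expR_gt0.
Qed.

(** In logarithmic scale an inversion is a reflection. *)
Lemma dtt_inv (A : set R) : measurable A -> A `<=` [set x | 0 < x]%R ->
  dtt [set x | (0 < x)%R /\ A x^-1%R] = dtt A.
Proof.
move=> mA Apos.
have mA' : measurable [set x | (0 < x)%R /\ A x^-1%R].
  rewrite (_ : mkset _ = pos `&` (@GRing.inv R @^-1` A)); last first.
    by apply/seteqP; split => x [] /=; rewrite in_itv/= andbT.
  have mc := @measurable_inv_pos R.
  by apply: mc => //; exact: measurable_itv.
rewrite !dttE// -[RHS]lebesgue_measureN; last exact: measurable_preimage_expR.
congr (mu _); apply/seteqP; split => x /=; rewrite expRN.
  by move=> [].
by move=> Ax; split => //; exact: expR_gt0.
Qed.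

Lemma tnorm_dil E (c : R) f : (0 < c)%R -> nneg_meas f ->
  tnorm E (fun x => f (c * x)%R) = tnorm E f.
Proof.
move=> c0 nf; apply: tnorm_equidistributed => l.
rewrite -[RHS](dtt_dil c0 (measurable_superlevel l nf)); last by move=> x [].
by congr (dtt _); apply/seteqP; split => x /= [x0]; rewrite ?pmulr_rgt0.
Qed.

Lemma tnorm_inv E f : nneg_meas f ->
  tnorm E (fun x => f x^-1%R) = tnorm E f.
Proof.
move=> nf; apply: tnorm_equidistributed => l.
rewrite -[RHS](dtt_inv (measurable_superlevel l nf)); last by move=> x [].
by congr (dtt _); apply/seteqP; split => x /= [x0]; rewrite ?invr_gt0.
Qed.

End tilde_norm.

Section directed.
Context {R : realType}.
Local Notation pos := (`]0%R, +oo[%classic : set R).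
Implicit Types (f g : R -> \bar R) (E : riSpace R) (d : bool).

(** The half-line cut off at u in the direction d. The inner norms of the spaces
    with superscript L and R are taken on it, for d false and true. *)
Definition idir d (u : R) : interval R := if d then `]u, +oo[ else `]0%R, u[.
Local Notation I d u := [set` idir d u].

Lemma in_idir d u x : (x \in idir d u) = if d then (u < x)%R else (0 < x < u)%R.
Proof. by case: d; rewrite /idir in_itv/= ?andbT. Qed.

Lemma in_idir_dil d (c u x : R) : (0 < c)%R ->
  ((c * x)%R \in idir d (c * u)%R) = (x \in idir d u).
Proof.
move=> c0; rewrite !in_idir; case: d; rewrite ?ltr_pM2l//.
by rewrite pmulr_rgt0.
Qed.

Lemma tnorm_on_le E (i : interval R) f g : nneg_meas f -> nneg_meas g ->
  (forall x, (0 < x)%R -> x \in i -> f x <= g x) ->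
  tnorm_on E [set` i] f <= tnorm_on E [set` i] g.
Proof.
move=> nf ng fg; apply: tnorm_le; [exact: nneg_meas_restrict..|].
move=> x x0; rewrite !patchE; case: ifPn => //; rewrite inE/= => xi.
exact: fg.
Qed.

Lemma tnorm_on_sub E (i j : interval R) f : nneg_meas f ->
  (forall x, (0 < x)%R -> x \in i -> x \in j) ->
  tnorm_on E [set` i] f <= tnorm_on E [set` j] f.
Proof.
move=> nf ij; apply: tnorm_le; [exact: nneg_meas_restrict..|].
move=> x x0; rewrite !patchE; case: ifPn => [|_].
  by rewrite inE/= => xi; rewrite mem_set//=; exact: ij.
by case: ifP => // _; apply nf.2.
Qed.

Lemma tnorm_on_le_tnorm E (i : interval R) f : nneg_meas f ->
  tnorm_on E [set` i] f <= tnorm E f.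
Proof.
move=> nf; apply: tnorm_le => //; first exact: nneg_meas_restrict.
by move=> x x0; rewrite patchE; case: ifP => // _; apply nf.2.
Qed.

Lemma tnorm_on_ge0 E (i : interval R) f : nneg_meas f -> 0 <= tnorm_on E [set` i] f.
Proof. by move=> nf; apply: tnorm_ge0; exact: nneg_meas_restrict. Qed.

Lemma tnorm_on_eq E (A : set R) f g : (forall x, (0 < x)%R -> A x -> f x = g x) ->
  tnorm_on E A f = tnorm_on E A g.
Proof.
move=> fg; apply: tnorm_eq => x x0; rewrite !patchE; case: ifPn => //.
by rewrite inE => /fg; exact.
Qed.

Lemma tnorm_on_scale E (k : R) (i : interval R) f : (0 <= k)%R -> nneg_meas f ->
  tnorm_on E [set` i] (fun x => k%:E * f x) = k%:E * tnorm_on E [set` i] f.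
Proof.
move=> k0 nf; have nr := nneg_meas_restrict i nf.
rewrite -(tnorm_scale E k0 nr).
by apply: tnorm_eq => x x0; rewrite !patchE; case: ifPn => //; rewrite mule0.
Qed.

Lemma tnorm_on_add E (i : interval R) f g : nneg_meas f -> nneg_meas g ->
  tnorm_on E [set` i] (fun x => f x + g x) <=
  tnorm_on E [set` i] f + tnorm_on E [set` i] g.
Proof.
move=> nf ng; apply: le_trans (tnorm_add _ _ _);
  [|exact: nneg_meas_restrict..].
rewrite le_eqVlt; apply/orP; left; apply/eqP; apply: tnorm_eq => x x0.
by rewrite !patchE; case: ifPn => //; rewrite adde0.
Qed.

Lemma tnorm_on_dil E d (c u : R) f : (0 < c)%R -> nneg_meas f ->
  tnorm_on E (I d u) (fun x => f (c * x)%R) = tnorm_on E (I d (c * u)) f.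
Proof.
move=> c0 nf; rewrite -[RHS](tnorm_dil _ c0); last exact: nneg_meas_restrict.
apply: tnorm_eq => x x0; rewrite !patchE.
by rewrite !(@mem_setE R) in_idir_dil.
Qed.

Lemma nneg_meas_tnorm_dir E d f : nneg_meas f ->
  nneg_meas (fun t => tnorm_on E (I d t) f).
Proof.
move=> nf; case: d; [apply: nneg_meas_ni|apply: nneg_meas_nd].
- by move=> x _; exact: tnorm_on_ge0.
- move=> x y x0 xy; apply: tnorm_on_sub => // z z0; rewrite !in_idir.
  exact: le_lt_trans.
- by move=> x _; exact: tnorm_on_ge0.
- move=> x y x0 xy; apply: tnorm_on_sub => // z z0; rewrite !in_idir z0/=.
  by move=> zx; exact: lt_le_trans xy.
Qed.

Lemma nneg_meas_dil (c : R) f : (0 < c)%R -> nneg_meas f ->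
  nneg_meas (fun x => f (c * x)%R).
Proof.
move=> c0 [mf f0]; split; last by move=> x x0; apply: f0; rewrite mulr_gt0.
apply: (measurable_comp _ _ mf (@mulrl_measurable R pos c)).
  exact: measurable_itv.
by move=> _ [x + <-]; rewrite /= !in_itv/= !andbT; exact: mulr_gt0.
Qed.

Lemma nneg_meas_pow (a : R) : nneg_meas (fun x : R => (x `^ a)%:E).
Proof.
apply: (@nneg_meas_EFin _ (fun x => x `^ a)%R).
  by apply: measurable_funTS; exact: measurable_powR.
by move=> x _; exact: powR_ge0.
Qed.

Lemma tnorm0 E : tnorm E (cst 0) = 0.
Proof.
have n0 : @nneg_meas R (cst 0) by apply: nneg_meas_cst; exact: lexx.
transitivity (tnorm E (fun x => 0%:E * cst 0 x)).
  by apply: tnorm_eq => x _; rewrite mul0e.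
by rewrite (tnorm_scale E (lexx 0%R) n0) mul0e.
Qed.

(** The norm N_n of the power on ]1, 2^n] satisfies N_(n+1) <= A + q N_n with
    q = 2^(-e) < 1: past 2 the power is q times its own dilate. *)
Let tnorm_pow_n E (e : R) (n : nat) : (0 < e)%R ->
  tnorm_on E `]1%R, (2 ^+ n)%R] (fun x => (x `^ (- e))%:E) <=
  tnorm_on E `]1%R, 2%R] (cst 1) * ((1 - 2 `^ (- e))^-1)%:E.
Proof.
move=> e0.
have n1 : @nneg_meas R (cst 1) by apply: nneg_meas_cst; exact: ler01.
have [A EA] : exists A : R, tnorm_on E `]1%R, 2%R] (cst 1) = A%:E.
  exists (fine (tnorm_on E `]1%R, 2%R] (cst 1))); rewrite fineK//.
  by rewrite ge0_fin_numE ?tnorm_on_ge0// tnorm_indic_fin ?ltr1n.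
have A0 : (0 <= A)%R by rewrite -lee_fin -EA tnorm_on_ge0.
set q := (2 `^ (- e))%R.
have q0 : (0 < q)%R by exact: powR_gt0.
have q1 : (q < 1)%R.
  rewrite /q powRN invf_lt1 ?powR_gt0//.
  have := @gt0_ltr_powR _ _ e0 1%R 2%R; rewrite powR1.
  by apply; rewrite ?nnegrE ?ler01 ?ltr1n.
have np := nneg_meas_pow (- e).
rewrite EA; elim: n => [|n IH].
  rewrite expr0 /tnorm_on set_itvoc0.
  rewrite (@tnorm_eq _ _ _ (cst 0)); last by move=> x _; rewrite patchE in_set0.
  by rewrite tnorm0 -EFinM lee_fin mulr_ge0 ?invr_ge0 ?subr_ge0 ?(ltW q1).
pose h := (fun x : R => (x `^ (- e))%:E) \_ `]1%R, (2 ^+ n)%R].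
have nh : nneg_meas h by exact: nneg_meas_restrict.
apply: (@le_trans _ _ (A%:E + q%:E * tnorm E h)).
  rewrite -(tnorm_dil E _ nh (c := 2^-1%R)) ?invr_gt0//.
  have nh2 := nneg_meas_dil (c:=2^-1%R) _ nh.
  rewrite -(tnorm_scale _ (ltW q0)); last by apply: nh2; rewrite invr_gt0.
  rewrite -EA /tnorm_on; apply: le_trans (tnorm_add _ _ _); first last.
  - apply: nneg_measM; first by apply: nneg_meas_cst; exact: ltW.
    by apply: nh2; rewrite invr_gt0.
  - exact: nneg_meas_restrict.
  apply: tnorm_le.
  - exact: nneg_meas_restrict.
  - apply: nneg_measD; first exact: nneg_meas_restrict.
    apply: nneg_measM; first by apply: nneg_meas_cst; exact: ltW.
    by apply: nh2; rewrite invr_gt0.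
  move=> x x0; rewrite /h !patchE !(@mem_setE R) !in_itv/=.
  have [x1|x1] := ltP 1%R x; last first.
    rewrite /= add0e; case: ifP => _; last by rewrite mule0.
    by rewrite -EFinM lee_fin mulr_ge0 ?powR_ge0.
  have [x2|x2] := leP x 2%R; rewrite /=.
    apply: (@le_trans _ _ 1).
      case: ifP => _; rewrite ?lee_fin//.
      rewrite powRN invf_le1 ?powR_gt0//.
      by rewrite -[X in (X <= _)%R](powRr0 x) ler_powR ?ltW.
    rewrite leeDl//; case: ifP => _; last by rewrite mule0.
    by rewrite -EFinM lee_fin mulr_ge0 ?powR_ge0 ?ltW.
  rewrite add0e.
  have -> : (1 < 2^-1 * x)%R by rewrite mulrC ltr_pdivlMr// mul1r.
  rewrite /= mulrC ler_pdivrMr// -exprSr.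
  case: ifP => _; last by rewrite mule0.
  rewrite -EFinM lee_fin /q -powRM ?divr_ge0 ?(ltW x0)//.
  by have -> : (2 * (x / 2) = x)%R by field.
apply: (@le_trans _ _ (A%:E + q%:E * (A%:E * ((1 - q)^-1)%:E))).
  by rewrite leeD2l// lee_pmul2l.
rewrite -!EFinM -EFinD lee_fin le_eqVlt; apply/orP; left; apply/eqP.
by field; rewrite subr_eq0 gt_eqF.
Qed.

(** The bound for ]1, 2^n] passes to the limit by the Fatou property. *)
Let tnorm_pow1 E (e : R) : (0 < e)%R ->
  tnorm_on E `]1%R, +oo[ (fun x => (x `^ (- e))%:E) < +oo.
Proof.
move=> e0.
have n1 : @nneg_meas R (cst 1) by apply: nneg_meas_cst; exact: ler01.
pose q := (2 `^ (- e))%R.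
apply: (@le_lt_trans _ _ (tnorm_on E `]1%R, 2%R] (cst 1) * ((1 - q)^-1)%:E)); last first.
  have := @tnorm_indic_fin _ E 1 2 ltr01 (ltr1n _ 2).
  have := @tnorm_on_ge0 E `]1%R, 2%R] _ n1.
  by case: tnorm_on => // A _ _; rewrite -EFinM ltry.
have np := nneg_meas_pow (- e).
pose f_ (n : nat) := (fun x : R => (x `^ (- e))%:E) \_ `]1%R, (2 ^+ n)%R].
pose f := (fun x : R => (x `^ (- e))%:E) \_ `]1%R, +oo[.
have nf_ n : nneg_meas (f_ n) by exact: nneg_meas_restrict.
have nf : nneg_meas f by exact: nneg_meas_restrict.
have cv : E (f_ n \o @dtt_map R) @[n --> \oo] --> E (f \o @dtt_map R).
  apply: ri_fatou.
  - by move=> n; exact: nneg_meas_comp_dtt_map.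
  - exact: nneg_meas_comp_dtt_map.
  apply: aeW => x _ /=; have := dtt_map_gt0 x; move: (dtt_map x) => y y0.
  have fy n : f_ n y = if (1 < y)%R && (y <= 2 ^+ n)%R then (y `^ (- e))%:E else 0.
    by rewrite /f_ patchE (@mem_setE R) in_itv.
  split.
    move=> m n mn; rewrite !fy; case: ltP => //= y1.
    case: ifP => [ym|_]; last by case: ifP; rewrite ?lee_fin ?powR_ge0.
    by rewrite (le_trans ym)// ler_weXn2l// ler1n.
  apply: cvg_near_cst.
  have [N yN] : exists N : nat, (y <= 2 ^+ N)%R.
    exists (Num.truncn y).+1; apply: (@le_trans _ _ (Num.truncn y).+1%:R).
      by apply/ltW; exact: truncnS_gt.
    by rewrite -natrX ler_nat; apply: ltnW; exact: ltn_expl.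
  exists N => // n /= Nn; rewrite fy /f patchE (@mem_setE R) in_itv/= andbT.
  have -> : (y <= 2 ^+ n)%R by rewrite (le_trans yN)// ler_weXn2l// ler1n.
  by rewrite andbT.
rewrite /tnorm_on tnormE// -(cvg_lim _ cv)//; apply: lime_le.
  by apply/cvg_ex; eexists; exact: cv.
by apply: nearW => n; rewrite -tnormE//; exact: tnorm_pow_n.
Qed.

(** The inversion exchanges the two half-lines. *)
Lemma tnorm_pow E d (e : R) : (0 < e)%R ->
  tnorm_on E (I d 1%R) (fun x => (x `^ (if d then - e else e))%:E) < +oo.
Proof.
move=> e0; case: d; first exact: tnorm_pow1.
have np := nneg_meas_pow (- e).
apply: le_lt_trans (tnorm_pow1 E e0).
rewrite /tnorm_on -[leRHS]tnorm_inv; last exact: nneg_meas_restrict.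
rewrite le_eqVlt; apply/orP; left; apply/eqP; apply: tnorm_eq => x x0.
rewrite !patchE !(@mem_setE R) !in_itv/= x0 andbT/=.
rewrite invf_gt1//; case: ifP => // _.
by rewrite -powR_inv1 ?ltW// -powRrM mulN1r opprK.
Qed.

End directed.

(** * Weights with power growth *)

Section growth.
Context {R : realType}.
Local Notation pos := (`]0%R, +oo[%classic : set R).
Local Notation I d u := [set` idir d u].
Implicit Types (E : riSpace R) (d : bool) (W : R -> R).

(** W grows at least like the power a and at most like the power b. The constant
    is explicit because W is to be multiplied by K(., f), over which the
    estimates must be uniform. *)
Definition growth (c a b : R) W := forall x y, (0 < x)%R -> (x <= y)%R ->
  (W y <= c * (y / x) `^ b * W x)%R /\ ((y / x) `^ a * W x <= c * W y)%R.

Definition weight W := measurable_fun pos W /\ forall x, (0 < x)%R -> (0 <= W x)%R.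

Lemma powR_ratio (t x y : R) : (0 < x)%R -> (0 < y)%R ->
  ((y / x) `^ t = y `^ t / x `^ t)%R.
Proof.
move=> x0 y0; apply: (mulIf (lt0r_neq0 (powR_gt0 t x0))).
rewrite -powRM ?divr_ge0 ?(ltW x0) ?(ltW y0)//.
by rewrite !divfK ?gt_eqF ?powR_gt0.
Qed.

Lemma nneg_meas_weight W : weight W -> nneg_meas (EFin \o W).
Proof. by move=> [mW W0]; exact: nneg_meas_EFin. Qed.

Lemma weightM W1 W2 : weight W1 -> weight W2 -> weight (fun x => W1 x * W2 x)%R.
Proof.
move=> [m1 W1p] [m2 W2p]; split; first exact: measurable_funM.
by move=> x x0; rewrite mulr_ge0 ?W1p ?W2p.
Qed.

Lemma weightV W : weight W -> (forall x, (0 < x)%R -> (0 < W x)%R) ->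
  weight (fun x => (W x)^-1)%R.
Proof.
move=> [mW W0] Wp; split; last by move=> x x0; rewrite invr_ge0 W0.
apply: (measurable_comp _ _ (@measurable_inv_pos R) mW).
  exact: measurable_itv.
by move=> _ [x + <-]; rewrite /= !in_itv/= !andbT; exact: Wp.
Qed.

Lemma weight_pow (a : R) : weight (fun x => x `^ a)%R.
Proof.
split; last by move=> x _; exact: powR_ge0.
by apply: measurable_funTS; exact: measurable_powR.
Qed.

Lemma growthM c1 a1 b1 W1 c2 a2 b2 W2 : (0 < c1)%R -> (0 < c2)%R ->
  weight W1 -> weight W2 ->
  growth c1 a1 b1 W1 -> growth c2 a2 b2 W2 ->
  growth (c1 * c2) (a1 + a2) (b1 + b2) (fun x => W1 x * W2 x)%R.
Proof.
move=> c10 c20 [_ W1p] [_ W2p] g1 g2 x y x0 xy.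
have y0 : (0 < y)%R by exact: lt_le_trans xy.
have [u1 l1] := g1 _ _ x0 xy; have [u2 l2] := g2 _ _ x0 xy.
have D p q : ((y / x) `^ (p + q) = (y / x) `^ p * (y / x) `^ q)%R.
  by rewrite powRD// (gt_eqF (divr_gt0 y0 x0)) implybT.
have := W1p _ x0; have := W2p _ x0; have := W1p _ y0; have := W2p _ y0.
move=> w2y w1y w2x w1x; rewrite !D; split.
  apply: le_trans (ler_pM w1y w2y u1 u2) _.
  by rewrite le_eqVlt; apply/orP; left; apply/eqP; ring.
have p1 : (0 <= (y / x) `^ a1 * W1 x)%R by rewrite mulr_ge0 ?powR_ge0.
have p2 : (0 <= (y / x) `^ a2 * W2 x)%R by rewrite mulr_ge0 ?powR_ge0.
have := ler_pM p1 p2 l1 l2.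
by move=> H; apply: le_trans (le_trans _ H) _;
  rewrite le_eqVlt; apply/orP; left; apply/eqP; ring.
Qed.

Lemma growthV c a b W : (forall x, (0 < x)%R -> (0 < W x)%R) ->
  growth c a b W -> growth c (- b) (- a) (fun x => (W x)^-1)%R.
Proof.
move=> Wp g x y x0 xy.
have y0 : (0 < y)%R by exact: lt_le_trans xy.
have [u l] := g _ _ x0 xy.
have wx := Wp _ x0; have wy := Wp _ y0.
have yx : (0 < y / x)%R by rewrite divr_gt0.
rewrite !powRN; split.
  rewrite -(ler_pM2l (mulr_gt0 (mulr_gt0 (powR_gt0 a yx) wx) wy)).
  have -> : ((y / x) `^ a * W x * W y / W y = (y / x) `^ a * W x)%R.
    by field; rewrite gt_eqF.
  have -> : ((y / x) `^ a * W x * W y * (c / (y / x) `^ a / W x) = c * W y)%R.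
    by field; rewrite !gt_eqF ?powR_gt0.
  exact: l.
rewrite -(ler_pM2l (mulr_gt0 (mulr_gt0 (powR_gt0 b yx) wx) wy)).
have -> : ((y / x) `^ b * W x * W y * (((y / x) `^ b)^-1 / W x) = W y)%R.
  by field; rewrite !gt_eqF ?powR_gt0.
have -> : ((y / x) `^ b * W x * W y * (c / W y) = c * (y / x) `^ b * W x)%R.
  by field; rewrite gt_eqF.
exact: u.
Qed.

Lemma growth_pow (t : R) : growth 1 t t (fun x => x `^ t)%R.
Proof.
move=> x y x0 xy; have y0 : (0 < y)%R by exact: lt_le_trans xy.
by rewrite !mul1r powR_ratio// divfK ?gt_eqF ?powR_gt0.
Qed.

Lemma SV_weight b : SV b -> weight b.
Proof. by case=> mb b0 _; split => // x x0; apply/ltW/b0. Qed.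

(** Compare x and y through the monotone functions equivalent to t^e b(t) and
    t^(-e) b(t); each equivalence is used at both points, whence the squares. *)
Lemma SV_growth b (e : R) : SV b -> (0 < e)%R ->
  exists2 c, (0 < c)%R & growth c (- e) e b.
Proof.
case=> _ b0 svb e0; have [[g gnd [c c0 gb]] [h hni [k k0 hb]]] := svb e e0.
exists (Num.max (c ^+ 2) (k ^+ 2))%R; first by rewrite lt_max exprn_gt0.
move=> x y x0 xy; have y0 : (0 < y)%R by exact: lt_le_trans xy.
have X0 : (0 < x `^ e)%R by exact: powR_gt0.
have Y0 : (0 < y `^ e)%R by exact: powR_gt0.
have r := powR_ratio e x0 y0.
have bx := b0 _ x0; have by' := b0 _ y0.
have M1 : (c ^+ 2 <= Num.max (c ^+ 2) (k ^+ 2))%R by rewrite le_max lexx.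
have M2 : (k ^+ 2 <= Num.max (c ^+ 2) (k ^+ 2))%R by rewrite le_max lexx orbT.
split.
  apply: (@le_trans _ _ (k ^+ 2 * (y / x) `^ e * b x)%R); last first.
    by rewrite ler_pM2r// ler_pM2r// r divr_gt0.
  have [h1 _] := hb _ y0; have [_ h2] := hb _ x0.
  have h3 := hni _ _ x0 xy; rewrite !powRN in h1 h2.
  rewrite r -(ler_pM2l (x:=(y `^ e)^-1%R)) ?invr_gt0//.
  apply: (le_trans h1); apply: (@le_trans _ _ (k * h x)%R); first by rewrite ler_pM2l.
  apply: (@le_trans _ _ (k * (k * ((x `^ e)^-1 * b x)))%R).
    by rewrite ler_pM2l.
  rewrite le_eqVlt; apply/orP; left; apply/eqP; field.
  by rewrite !gt_eqF.
apply: (@le_trans _ _ (c ^+ 2 * b y)%R); last by rewrite ler_pM2r.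
have [h1 _] := gb _ x0; have [_ h2] := gb _ y0.
have h3 := gnd _ _ x0 xy.
rewrite powRN r -(ler_pM2l Y0).
have -> : (y `^ e * ((y `^ e / x `^ e)^-1 * b x) = x `^ e * b x)%R.
  by field; rewrite !gt_eqF.
apply: (le_trans h1); apply: (@le_trans _ _ (c * g y)%R); first by rewrite ler_pM2l.
apply: (@le_trans _ _ (c * (c * (y `^ e * b y)))%R).
  by rewrite ler_pM2l.
by rewrite le_eqVlt; apply/orP; left; apply/eqP; ring.
Qed.

Lemma growth_decay d c a b W : growth c a b W -> forall u s, (0 < u)%R ->
  (0 < s)%R -> s \in idir d u ->
  (W s <= c * (u^-1 * s) `^ (if d then b else a) * W u)%R.
Proof.
move=> g u s u0 s0; rewrite in_idir (mulrC u^-1%R); case: d => [us|/andP[_ su]].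
  by have [] := g _ _ u0 (ltW us).
have [_] := g _ _ s0 (ltW su).
rewrite !powR_ratio// => l.
rewrite -(ler_pM2l (divr_gt0 (powR_gt0 a u0) (powR_gt0 a s0))).
apply: (le_trans l); rewrite le_eqVlt; apply/orP; left; apply/eqP.
by field; rewrite !gt_eqF ?powR_gt0.
Qed.

(** On the half-line at u the weight is at most W(u) times a dilate of a power,
    whose norm does not depend on u. *)
Lemma tnorm_growth_le E d c a b : (0 < c)%R -> (if d then b < 0 else 0 < a)%R ->
  exists2 C, (0 < C)%R & forall W, weight W -> growth c a b W ->
    forall u, (0 < u)%R ->
    tnorm_on E (I d u) (EFin \o W) <= (C * W u)%:E.
Proof.
move=> c0 dec; pose e := (if d then - b else a)%R.
have e0 : (0 < e)%R by move: dec; rewrite /e; case: (d); rewrite ?oppr_gt0.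
have eE : (if d then b else a)%R = (if d then - e else e)%R.
  by rewrite /e; case: (d); rewrite ?opprK.
have := tnorm_pow E d e0; have := nneg_meas_pow (if d then - e else e)%R.
set p := (fun x : R => _) => np.
have := @tnorm_on_ge0 _ E (idir d 1%R) _ np.
case Ep : (tnorm_on E _ _) => [P| |]// P0 _; rewrite lee_fin in P0.
exists (c * (P + 1))%R; first by rewrite mulr_gt0// ltr_wpDl.
move=> W wW g u u0; have Wu : (0 <= W u)%R by apply wW.2.
have u0' : (0 < u^-1)%R by rewrite invr_gt0.
have nd : nneg_meas (fun s => p (u^-1 * s)%R) by exact: nneg_meas_dil.
apply: (@le_trans _ _ (tnorm_on E (I d u)
    (fun s => (c * W u)%:E * p (u^-1 * s)%R))).
  apply: tnorm_on_le.
  - exact: nneg_meas_weight.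
  - by apply: nneg_measM => //; apply: nneg_meas_cst; rewrite mulr_ge0 ?(ltW c0).
  - move=> s s0 sI; rewrite /= /p -EFinM lee_fin -eE mulrAC.
    exact: growth_decay.
rewrite tnorm_on_scale//; last by rewrite mulr_ge0 ?(ltW c0).
rewrite (@tnorm_on_dil _ E d u^-1%R)// mulVf ?gt_eqF// Ep -EFinM lee_fin.
by rewrite [leRHS]mulrAC ler_wpM2l ?mulr_ge0 ?(ltW c0)// lerDl.
Qed.

(** A dyadic interval inside the half-line at u, on which any weight with power
    growth is comparable to its value at u. *)
Definition window d (u : R) : interval R :=
  if d then `]u, (2 * u)%R] else `](4^-1 * u)%R, (2^-1 * u)%R].

Lemma window_sub d u s : (0 < u)%R -> s \in window d u -> s \in idir d u.
Proof.
move=> u0; rewrite in_idir /window; case: d; rewrite in_itv/= => /andP[l r] //.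
by apply/andP; split; lra.
Qed.

Lemma in_window_dil d (c u x : R) : (0 < c)%R ->
  ((c * x)%R \in window d (c * u)%R) = (x \in window d u).
Proof.
move=> c0; rewrite /window; case: d; rewrite !in_itv/= ?(mulrCA _ c)
  !(ltr_pM2l c0, ler_pM2l c0)//.
Qed.

Let powR_bounds (r t : R) : (1 <= r)%R -> (r <= 4)%R ->
  (r `^ t <= 4 `^ `|t|)%R /\ (1 <= 4 `^ `|t| * r `^ t)%R.
Proof.
move=> r1 r4; have r0 : (0 < r)%R by exact: lt_le_trans r1.
have U (q : R) : (0 <= q)%R -> (1 <= r `^ q <= 4 `^ q)%R.
  move=> q0; rewrite ge0_ler_powR ?nnegrE ?(ltW r0)// andbT.
  have := @ge0_ler_powR _ _ q0 1%R r; rewrite powR1.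
  by apply; rewrite ?nnegrE ?(ltW r0).
have [t0|t0] := leP 0%R t.
  have /andP[h1 h2] := U _ t0; rewrite ger0_norm//; split => //.
  by rewrite -[leLHS](mulr1) ler_pM ?(le_trans h1 h2).
have nt : (0 <= - t)%R by rewrite oppr_ge0 ltW.
have /andP[h1 h2] := U _ nt.
have p0 : (0 < r `^ t)%R by exact: powR_gt0.
rewrite ltr0_norm//; rewrite (powRN r) in h1 h2; split.
  apply: (@le_trans _ _ 1%R); first by rewrite -[leLHS]invrK invf_le1// invr_gt0.
  exact: le_trans h2.
by rewrite -ler_pdivrMr// mul1r.
Qed.

Lemma growth_window d c a b : (0 < c)%R ->
  exists2 C, (0 < C)%R & forall W, weight W -> growth c a b W ->
    forall u s, (0 < u)%R -> s \in window d u -> (W u <= C * W s)%R.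
Proof.
move=> c0; exists (c * (4 `^ `|a| + 4 `^ `|b|))%R.
  by rewrite mulr_gt0// addr_gt0 ?powR_gt0.
have pa : (0 < 4 `^ `|a| :> R)%R by rewrite powR_gt0.
have pb : (0 < 4 `^ `|b| :> R)%R by rewrite powR_gt0.
move=> W [mW W0] g u s u0; rewrite /window; case: d; rewrite in_itv/= => /andP[us su].
  have [_ l] := g _ _ u0 (ltW us).
  have s0 : (0 < s)%R by exact: lt_trans us.
  have [] := @powR_bounds (s / u)%R a.
  - by rewrite ler_pdivlMr// mul1r ltW.
  - by rewrite ler_pdivrMr//; lra.
  move=> _ h; have wu := W0 _ u0; have ws := W0 _ s0.
  apply: (@le_trans _ _ (4 `^ `|a| * (c * W s))%R).
    apply: (@le_trans _ _ (4 `^ `|a| * ((s / u) `^ a * W u))%R).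
      by rewrite mulrA -[leLHS]mul1r ler_wpM2r.
    by rewrite ler_pM2l.
  rewrite mulrCA mulrA ler_wpM2r// ler_pM2l// lerDl; exact: ltW.
have s0 : (0 < s)%R by apply: lt_trans us; rewrite mulr_gt0.
have su' : (s <= u)%R by lra.
have [l _] := g _ _ s0 su'.
have [] := @powR_bounds (u / s)%R b.
- by rewrite ler_pdivlMr// mul1r.
- by rewrite ler_pdivrMr//; lra.
move=> h _; have ws := W0 _ s0; apply: (le_trans l).
rewrite ler_wpM2r// ler_pM2l//; apply: (le_trans h); rewrite lerDr; exact: ltW.
Qed.

Lemma tnorm_window E d (u : R) : (0 < u)%R ->
  tnorm_on E [set` window d u] (cst 1) = tnorm_on E [set` window d 1%R] (cst 1).
Proof.
move=> u0.
have n1 : @nneg_meas R (cst 1) by apply: nneg_meas_cst; exact: ler01.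
have nw : nneg_meas (cst 1 \_ [set` window d u]) by exact: nneg_meas_restrict.
rewrite [LHS](_ : _ = tnorm E (fun x => (cst 1 \_ [set` window d u]) (u * x)%R));
  last by rewrite (tnorm_dil E u0 nw).
apply: tnorm_eq => x x0; rewrite !patchE !(@mem_setE R).
by rewrite -{2}(mulr1 u) in_window_dil.
Qed.

(** A bounded interval away from 0 has finite positive dt/t-measure. *)
Lemma tnorm_window1 E d : exists2 k : R, (0 < k)%R &
  tnorm_on E [set` window d 1%R] (cst 1) = k%:E.
Proof.
have n1 : @nneg_meas R (cst 1) by apply: nneg_meas_cst; exact: ler01.
have [l [r [l0 lr ->]]] : exists l r : R, [/\ (0 < l)%R, (l < r)%R & window d 1%R = `]l, r]].
  by case: d; [exists 1%R, (2 * 1)%R|exists (4^-1 * 1)%R, (2^-1 * 1)%R]; split => //; lra.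
have fin := tnorm_indic_fin E l0 lr.
have gt : 0 < tnorm_on E `]l, r] (cst 1).
  apply: (tnorm_gt0 _ l0 lr); first exact: nneg_meas_restrict.
  by move=> x lx xr; rewrite patchE (@mem_setE R) in_itv/= lx xr lte_fin.
exists (fine (tnorm_on E `]l, r] (cst 1))); first by rewrite fine_gt0// gt fin.
by rewrite fineK// gt0_fin_numE.
Qed.

(** The half-line at u contains the window, and the norm of the constant 1 on
    the window does not depend on u, by dilation. *)
Lemma tnorm_growth_ge E d c a b : (0 < c)%R ->
  exists2 C, (0 < C)%R & forall W, weight W -> growth c a b W ->
    forall u, (0 < u)%R -> (W u)%:E <= C%:E * tnorm_on E (I d u) (EFin \o W).
Proof.
move=> c0; have [C C0 HC] := growth_window d a b c0.
have [k k0 kE] := tnorm_window1 E d.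
have n1 : @nneg_meas R (cst 1) by apply: nneg_meas_cst; exact: ler01.
exists (C / k)%R; first exact: divr_gt0.
move=> W wW g u u0; have Wu : (0 <= W u)%R by apply wW.2.
have h0 : (0 <= W u / C)%R by rewrite divr_ge0// ltW.
have : (W u / C)%:E * k%:E <= tnorm_on E (I d u) (EFin \o W).
  rewrite -kE -(tnorm_window E d u0) -(tnorm_on_scale E _ h0 n1).
  apply: (@le_trans _ _ (tnorm_on E [set` window d u] (EFin \o W))); last first.
    apply: tnorm_on_sub; first exact: nneg_meas_weight.
    by move=> x _; exact: window_sub.
  apply: tnorm_on_le; [|exact: nneg_meas_weight|].
    by apply: nneg_measM => //; exact: nneg_meas_cst.
  move=> x x0 xw; rewrite mule1 lee_fin ler_pdivrMr// mulrC.
  exact: HC.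
rewrite -(@lee_pmul2l _ (C / k)%:E) ?fin_numE ?lte_fin ?divr_gt0//.
by rewrite -!EFinM (_ : C / k * (W u / C * k) = W u)%R//; field; rewrite !gt_eqF.
Qed.

End growth.

Section tails.
Context {R : realType}.
Local Notation pos := (`]0%R, +oo[%classic : set R).
Local Notation I d u := [set` idir d u].
Implicit Types (E F : riSpace R) (d : bool) (W : R -> R).

(** A fixed positive weight of power growth, for which the constant can be left
    implicit. *)
Definition pweight (a b : R) W := [/\ weight W, forall x, (0 < x)%R -> (0 < W x)%R
  & exists2 c, (0 < c)%R & growth c a b W].

Lemma pweightM a1 b1 W1 a2 b2 W2 : pweight a1 b1 W1 -> pweight a2 b2 W2 ->
  pweight (a1 + a2) (b1 + b2) (fun x => W1 x * W2 x)%R.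
Proof.
move=> [w1 p1 [c1 c10 g1]] [w2 p2 [c2 c20 g2]]; split.
- exact: weightM.
- by move=> x x0; rewrite mulr_gt0 ?p1 ?p2.
- by exists (c1 * c2)%R; [exact: mulr_gt0|exact: growthM].
Qed.

Lemma pweightV a b W : pweight a b W -> pweight (- b) (- a) (fun x => (W x)^-1)%R.
Proof.
move=> [w p [c c0 g]]; split.
- exact: weightV.
- by move=> x x0; rewrite invr_gt0 p.
- by exists c => //; exact: growthV.
Qed.

Lemma pweight_pow (t : R) : pweight t t (fun x => x `^ t)%R.
Proof.
split; [exact: weight_pow|by move=> x x0; exact: powR_gt0|].
by exists 1%R => //; exact: growth_pow.
Qed.

Lemma pweight_SV b (e : R) : SV b -> (0 < e)%R -> pweight (- e) e b.
Proof.
move=> svb e0; split; [exact: SV_weight|by case: svb|exact: SV_growth].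
Qed.

Lemma tnorm_pweight_le E d a b W : (if d then b < 0 else 0 < a)%R ->
  pweight a b W -> exists2 C, (0 < C)%R & forall u, (0 < u)%R ->
    tnorm_on E (I d u) (EFin \o W) <= (C * W u)%:E.
Proof.
move=> dec [w _ [c c0 g]]; have [C C0 H] := tnorm_growth_le E c0 dec.
by exists C => // u u0; exact: H.
Qed.

Definition tail E d W (u : R) : R := fine (tnorm_on E (I d u) (EFin \o W)).

Section tail.
Context (E : riSpace R) (d : bool) (a b : R) (W : R -> R).
Hypothesis pW : pweight a b W.
Hypothesis finW : tnorm_on E (I d 1%R) (EFin \o W) < +oo.

Let nW : nneg_meas (EFin \o W).
Proof. by case: pW => w _ _; exact: nneg_meas_weight. Qed.

(** The tail at y is the norm, on the half-line at x, of the dilate of W by y/x,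
    and the growth of W compares this dilate with W. *)
Let tail_bounds : exists2 c, (0 < c)%R & forall x y, (0 < x)%R -> (x <= y)%R ->
  tnorm_on E (I d y) (EFin \o W) <=
    (c * (y / x) `^ b)%:E * tnorm_on E (I d x) (EFin \o W) /\
  ((y / x) `^ a)%:E * tnorm_on E (I d x) (EFin \o W) <=
    c%:E * tnorm_on E (I d y) (EFin \o W).
Proof.
have [_ _ [c c0 g]] := pW; exists c; [exact: c0|move=> x y x0 xy].
have y0 : (0 < y)%R by exact: lt_le_trans xy.
have l1 : (1 <= y / x)%R by rewrite ler_pdivlMr// mul1r.
have l0 : (0 < y / x)%R by exact: divr_gt0.
have yE : (y / x * x = y)%R by apply: divfK; rewrite gt_eqF.
have EE : tnorm_on E (I d y) (EFin \o W) =
    tnorm_on E (I d x) (fun s => (EFin \o W) (y / x * s)%R).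
  by rewrite (tnorm_on_dil E d x l0 nW) yE.
rewrite EE; have nWl : nneg_meas (fun s => (EFin \o W) (y / x * s)%R) by exact: nneg_meas_dil.
have G s : (0 < s)%R -> (W (y / x * s) <= c * (y / x) `^ b * W s)%R /\
    ((y / x) `^ a * W s <= c * W (y / x * s))%R.
  move=> s0; have sE : (y / x * s / s = y / x)%R by apply: mulfK; rewrite gt_eqF.
  have le_s : (s <= y / x * s)%R by rewrite -[leLHS]mul1r ler_pM2r.
  by have := g s (y / x * s)%R s0 le_s; rewrite sE.
split.
  have cb : (0 <= c * (y / x) `^ b)%R by rewrite mulr_ge0 ?powR_ge0 ?ltW.
  rewrite -(tnorm_on_scale E _ cb nW); apply: tnorm_on_le; first exact: nWl.
    by apply: nneg_measM; [exact: nneg_meas_cst|exact: nW].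
  by move=> s s0 _; rewrite -EFinM lee_fin; have [] := G s s0.
have pa : (0 <= (y / x) `^ a)%R by exact: powR_ge0.
rewrite -(tnorm_on_scale E _ pa nW) -(tnorm_on_scale E _ (ltW c0) nWl).
apply: tnorm_on_le.
- by apply: nneg_measM; [exact: nneg_meas_cst|exact: nW].
- by apply: nneg_measM; [apply: nneg_meas_cst; exact: ltW|exact: nWl].
by move=> s s0 _; rewrite -!EFinM lee_fin; have [] := G s s0.
Qed.

(** Finiteness at 1 propagates to every u by [tail_bounds]. *)
Lemma tailE (u : R) : (0 < u)%R ->
  tnorm_on E (I d u) (EFin \o W) = (tail E d W u)%:E.
Proof.
move=> u0; suff fu : tnorm_on E (I d u) (EFin \o W) < +oo.
  by rewrite /tail fineK; [|rewrite ge0_fin_numE; [exact: fu|exact: tnorm_on_ge0]].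
have fin1 (k : R) : (0 <= k)%R -> k%:E * tnorm_on E (I d 1%R) (EFin \o W) < +oo.
  by move=> k0; rewrite lte_mul_pinfty; [|rewrite lee_fin; exact: k0| |exact: finW].
have [c c0 H] := tail_bounds; have [u1|u1] := leP 1%R u.
  have [h _] := H _ _ ltr01 u1; apply: (le_lt_trans h); apply: fin1.
  by rewrite mulr_ge0 ?powR_ge0 ?ltW.
have [_ h] := H _ _ u0 (ltW u1); have {h} := le_lt_trans h (fin1 _ (ltW c0)).
case: (tnorm_on E (I d u) _) => [r _|h|_]; [exact: ltry| |by []].
by move: h; rewrite gt0_muley ?lte_fin ?powR_gt0 ?divr_gt0.
Qed.

Lemma tail_gt0 (u : R) : (0 < u)%R -> (0 < tail E d W u)%R.
Proof.
move=> u0; rewrite -lte_fin -(tailE u0).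
have [_ p _] := pW; have [l [r [l0 lr sub]]] : exists l r : R,
    [/\ (0 < l)%R, (l < r)%R & forall x, (l < x)%R -> (x <= r)%R -> x \in idir d u].
  case: (d); [exists u, (2 * u)%R|exists (4^-1 * u)%R, (2^-1 * u)%R].
    by split => //; [lra|move=> x ux xu; rewrite in_idir].
  split => //; [by rewrite mulr_gt0|lra|move=> x ux xu; rewrite in_idir].
  by apply/andP; split; [apply: lt_trans ux; rewrite mulr_gt0|lra].
apply: (tnorm_gt0 _ l0 lr); first exact: nneg_meas_restrict.
move=> x lx xr; rewrite patchE (@mem_setE R) (sub _ lx xr) /= lte_fin; apply: p.
exact: lt_trans lx.
Qed.

Lemma pweight_tail : pweight a b (tail E d W).
Proof.
have nT := nneg_meas_tnorm_dir E d nW; split.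
- split; last by move=> x x0; apply/ltW/tail_gt0.
  by case: nT => mT _; exact: (measurableT_comp (@fine_measurable R setT measurableT) mT).
- exact: tail_gt0.
have [c c0 H] := tail_bounds; exists c; [exact: c0|move=> x y x0 xy].
have y0 : (0 < y)%R by exact: lt_le_trans xy.
by have := H _ _ x0 xy; rewrite (tailE x0) (tailE y0) -!EFinM !lee_fin.
Qed.

End tail.

Lemma pweight_le_tail E d a b W : pweight a b W ->
  tnorm_on E (I d 1%R) (EFin \o W) < +oo ->
  exists2 C, (0 < C)%R & forall u, (0 < u)%R -> (W u <= C * tail E d W u)%R.
Proof.
move=> pW fW; have [w _ [c c0 g]] := pW.
have [C C0 H] := tnorm_growth_ge E d a b c0.
exists C => // u u0; rewrite -lee_fin EFinM -(tailE pW fW u0); exact: H.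
Qed.

End tails.

(** * Iterated norms in one direction *)

Section directed_estimates.
Context {R : realType}.
Local Notation pos := (`]0%R, +oo[%classic : set R).
Local Notation I d u := [set` idir d u].
Implicit Types (E F : riSpace R) (d : bool) (b w k : R -> R).

(** The two monotonicity properties of a K-functional: k is non-decreasing and
    k(s)/s is non-increasing. *)
Definition quasiconcave k := weight k /\ growth 1 0 1 k.

Definition inner F d w k (t : R) : \bar R :=
  tnorm_on F (I d t) (EFin \o (fun s => w s * k s)%R).

Definition outer F d b w k (t : R) : \bar R := (b t)%:E * inner F d w k t.

Lemma nneg_meas_inner F d w k : weight w -> weight k -> nneg_meas (inner F d w k).
Proof.
by move=> ww wk; apply: nneg_meas_tnorm_dir; apply: nneg_meas_weight; exact: weightM.
Qed.

Lemma nneg_meas_outer F d b w k : weight b -> weight w -> weight k ->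
  nneg_meas (outer F d b w k).
Proof.
move=> wb ww wk; apply: nneg_measM; first exact: nneg_meas_weight.
exact: nneg_meas_inner.
Qed.

(** The point u is negligible for dt/t. *)
Lemma tnorm_split E d (u : R) f : nneg_meas f ->
  tnorm E f <= tnorm_on E (I d u) f + tnorm_on E (I (~~ d) u) f.
Proof.
move=> nf; apply: le_trans (tnorm_add _ _ _); [|exact: nneg_meas_restrict..].
apply: (@tnorm_le_but _ u); [exact: nf| |].
  by apply: nneg_measD; exact: nneg_meas_restrict.
move=> x x0 xu; rewrite !patchE !(@mem_setE R) !in_idir.
have f0 : 0 <= f x by apply nf.2.
by case: d => /=; rewrite x0/=; case: (ltgtP x u) xu => //= _ _;
  rewrite ?add0e ?adde0.
Qed.

Lemma inner_le_inner F d w k (t u : R) : weight w -> weight k ->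
  (0 < t)%R -> (0 < u)%R -> t \in idir d u -> inner F d w k t <= inner F d w k u.
Proof.
move=> ww wk t0 u0 tu; apply: tnorm_on_sub.
  by apply: nneg_meas_weight; exact: weightM.
move=> x x0; move: tu; rewrite !in_idir; case: d.
  by move=> /lt_trans; exact.
by move=> /andP[_ tu] /andP[-> xt]/=; exact: lt_trans tu.
Qed.

Lemma idirN d (t u : R) : (0 < t)%R -> (0 < u)%R ->
  (t \in idir (~~ d) u) = (u \in idir d t).
Proof. by move=> t0 u0; rewrite !in_idir; case: d; rewrite /= ?t0 ?u0. Qed.

(** The product of w and k has power growth, with a constant that does not
    depend on k. *)
Lemma inner_ge F d (lo hi : R) w : pweight lo hi w -> exists2 C, (0 < C)%R &
  forall k u, quasiconcave k -> (0 < u)%R ->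
    (w u * k u)%:E <= C%:E * inner F d w k u.
Proof.
move=> [ww _ [c c0 g]].
have [C C0 H] := tnorm_growth_ge F d (lo + 0) (hi + 1) (mulr_gt0 c0 ltr01).
exists C => [//|k u [wk gk] u0].
apply: (H (fun s => w s * k s)%R _ _ _ u0); first exact: weightM.
exact: growthM.
Qed.

Lemma local_le_outer E F d b w k (u : R) : weight b -> weight w -> weight k ->
  tnorm_on E (I d u) (outer F d b w k) <= tnorm E (outer F d b w k).
Proof. by move=> *; apply: tnorm_on_le_tnorm; exact: nneg_meas_outer. Qed.

(** On the half-line opposite to d, the inner norm at t is at least the inner
    norm at u, which comes out of the outer norm as a factor. It may be infinite,
    hence the detour through its finite lower bounds. *)
Lemma tail_inner_le_outer E F d b w k (B u : R) : weight b -> weight w -> weight k ->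
  (0 < u)%R -> tnorm_on E (I (~~ d) u) (EFin \o b) = B%:E ->
  tnorm_on E (I (~~ d) u) (EFin \o b) * inner F d w k u <=
    tnorm E (outer F d b w k).
Proof.
move=> wb ww wk u0 BE.
have nb := nneg_meas_weight wb.
have ni := nneg_meas_inner F d ww wk.
have B0 : (0 <= B)%R by rewrite -lee_fin -BE tnorm_on_ge0.
have H (r : R) : (0 <= r)%R -> r%:E <= inner F d w k u ->
    r%:E * B%:E <= tnorm E (outer F d b w k).
  move=> r0 ri; rewrite -BE -(tnorm_on_scale E _ r0 nb).
  apply: le_trans (@tnorm_on_le_tnorm _ E (idir (~~ d) u) _ _);
    last exact: nneg_meas_outer.
  apply: tnorm_on_le.
  - by apply: nneg_measM; [exact: nneg_meas_cst|exact: nb].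
  - exact: nneg_meas_outer.
  move=> t t0; rewrite idirN// => tu; rewrite /outer [leRHS]muleC.
  apply: lee_wpmul2r; first by apply nb.2.
  by apply: (le_trans ri); exact: inner_le_inner.
rewrite BE muleC; have := ni.2 u u0; case: (inner F d w k u) H => [r H r0|H _|//].
  by apply: H.
move: B0; rewrite le_eqVlt => /predU1P[<-|B0].
  by rewrite mule0; apply: tnorm_ge0; exact: nneg_meas_outer.
rewrite gt0_mulye// leye_eq; apply/eqP.
have : 0 <= tnorm E (outer F d b w k) by apply: tnorm_ge0; exact: nneg_meas_outer.
case: (tnorm E _) H => [s H|//|//] s0.
have := H ((s + 1) / B)%R; rewrite leey -EFinM divfK ?gt_eqF// lee_fin.
have p : (0 <= (s + 1) / B)%R by rewrite divr_ge0 ?ltW// ltr_wpDl.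
by move=> /(_ p isT); rewrite gerDl ler10.
Qed.

(** On the half-line at u the function k0 is dominated by k. On the opposite
    one, the inner norm of k0 at t splits at u; the part on the far side is at
    most w(u) k(u) up to a constant, hence absorbed by the inner norm of k at u
    ([inner_ge]). *)
Lemma outer_le E F d (lo hi : R) b w (beta : R -> R) (c1 c2 : R) :
  weight b -> pweight lo hi w ->
  (forall u, (0 < u)%R -> tnorm_on E (I (~~ d) u) (EFin \o b) = (beta u)%:E) ->
  (forall u, (0 < u)%R -> (0 < beta u)%R) -> (0 < c1)%R -> (0 < c2)%R ->
  exists2 C, (0 < C)%R & forall k0 k u, weight k0 -> quasiconcave k -> (0 < u)%R ->
  (forall s, (0 < s)%R -> s \in idir d u -> (k0 s <= c1 * k s)%R) ->
  tnorm_on F (I (~~ d) u) (EFin \o (fun s => w s * k0 s)%R) <= (c2 * (w u * k u))%:E ->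
  tnorm E (outer F d b w k0) <= C%:E *
    (tnorm_on E (I d u) (outer F d b w k) +
     tnorm_on E (I (~~ d) u) (EFin \o b) * inner F d w k u).
Proof.
move=> wb pw betaE beta0 c10 c20.
have [ww _ _] := pw.
have [C C0 HC] := inner_ge F d pw.
pose D := (c1 + c2 * C)%R.
have D0 : (0 < D)%R by rewrite addr_gt0 ?mulr_gt0.
exists (c1 + D)%R; first exact: addr_gt0.
move=> k0 k u wk0 qk u0 k0k hfar.
have wk := qk.1.
have nw0 : nneg_meas (EFin \o (fun s => w s * k0 s)%R).
  by apply: nneg_meas_weight; exact: weightM.
have nw : nneg_meas (EFin \o (fun s => w s * k s)%R).
  by apply: nneg_meas_weight; exact: weightM.
have nb := nneg_meas_weight wb.
have no0 := nneg_meas_outer F d wb ww wk0.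
have no := nneg_meas_outer F d wb ww wk.
have ni0 := nneg_meas_inner F d ww wk0.
have ni := nneg_meas_inner F d ww wk.
have near t : (0 < t)%R -> (forall s, (0 < s)%R -> s \in idir d t -> s \in idir d u) ->
    inner F d w k0 t <= c1%:E * inner F d w k t.
  move=> t0 sub; rewrite /inner -(tnorm_on_scale F _ (ltW c10) nw).
  apply: tnorm_on_le; first exact: nw0.
    by apply: nneg_measM; [apply: nneg_meas_cst; exact: ltW|exact: nw].
  move=> s s0 st; rewrite /= -EFinM lee_fin mulrCA ler_wpM2l//; first by apply ww.2.
  by apply: k0k => //; exact: sub.
have far t : (0 < t)%R -> inner F d w k0 t <= D%:E * inner F d w k u.
  move=> t0; apply: le_trans (tnorm_on_le_tnorm _ _ nw0) _.
  apply: le_trans (tnorm_split _ d u nw0) _.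
  rewrite EFinD ge0_muleDl ?lee_fin ?mulr_ge0 ?(ltW c10) ?(ltW c20) ?(ltW C0)//.
  apply: leeD; first exact: near.
  apply: (le_trans hfar); rewrite !EFinM -muleA lee_pmul2l ?lte_fin// -EFinM.
  exact: HC.
apply: le_trans (tnorm_split _ d u no0) _.
rewrite EFinD ge0_muleDl ?lee_fin ?(ltW c10) ?(ltW D0)//.
have A0 : 0 <= tnorm_on E (I d u) (outer F d b w k) by exact: tnorm_on_ge0.
have i0 := ni.2 u u0.
have B0 : 0 <= tnorm_on E (I (~~ d) u) (EFin \o b) by exact: tnorm_on_ge0.
have Bi : 0 <= tnorm_on E (I (~~ d) u) (EFin \o b) * inner F d w k u by exact: mule_ge0.
apply: leeD.
  apply: (@le_trans _ _ (c1%:E * tnorm_on E (I d u) (outer F d b w k))).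
    rewrite -(tnorm_on_scale E _ (ltW c10) no).
    apply: tnorm_on_le; first exact: no0.
      by apply: nneg_measM; [apply: nneg_meas_cst; exact: ltW|exact: no].
    move=> t t0 tu; rewrite /outer muleCA; apply: lee_wpmul2l; first by apply nb.2.
    apply: near => // s s0; move: tu; rewrite !in_idir; case: (d).
      by move=> /lt_trans; exact.
    by move=> /andP[_ tu] /andP[-> st]/=; exact: lt_trans tu.
  by rewrite lee_pmul2l; [apply: leeDl; exact: Bi|by []|rewrite lte_fin].
apply: (@le_trans _ _ (D%:E *
    (tnorm_on E (I (~~ d) u) (EFin \o b) * inner F d w k u))); last first.
  by rewrite lee_pmul2l; [apply: leeDr; exact: A0|by []|rewrite lte_fin].
move: far i0; case: (inner F d w k u) => [r far r0| |//]; last first.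
  by move=> _ _; rewrite betaE// gt0_muley ?lte_fin ?beta0// gt0_muley ?leey.
have Dr : (0 <= D * r)%R by rewrite mulr_ge0 ?(ltW D0).
rewrite (muleC _ r%:E) muleA -EFinM -(tnorm_on_scale E _ Dr nb).
apply: tnorm_on_le; first exact: no0.
  by apply: nneg_measM; [exact: nneg_meas_cst|exact: nb].
move=> t t0 _; rewrite /outer muleC; apply: lee_wpmul2r; first by apply nb.2.
exact: far.
Qed.

End directed_estimates.

Section opposite.
Context {R : realType}.
Local Notation I d u := [set` idir d u].
Implicit Types (E F : riSpace R) (d : bool) (b w k : R -> R).

(** By [inner_ge] and [tail_inner_le_outer], the product of w(s), k(s) and the
    tail of b at s is bounded by the full norm. *)
Lemma quasiconcave_bound E F d (lb hb lo hi : R) b w :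
  pweight lb hb b -> pweight lo hi w ->
  tnorm_on E (I (~~ d) 1%R) (EFin \o b) < +oo ->
  exists2 C, (0 < C)%R & forall k (m : R), quasiconcave k ->
    tnorm E (outer F d b w k) = m%:E -> forall s, (0 < s)%R ->
    (k s <= C * m * (w s * tail E (~~ d) b s)^-1)%R.
Proof.
move=> pb pw fb; have [C C0 H] := inner_ge F d pw.
exists C; [exact: C0|move=> k m qk mE s s0].
have [wb _ _] := pb; have [ww w0 _] := pw.
have B0 := tail_gt0 pb fb s0; have BE := tailE pb fb s0.
have := tail_inner_le_outer F wb ww qk.1 s0 BE.
rewrite mE BE; have := H k s qk s0.
have ni := (nneg_meas_inner F d ww qk.1).2 s s0.
have ws := w0 s s0.
rewrite -[(_ * _)^-1%R]mul1r mulrA mulr1 ler_pdivlMr ?mulr_gt0//.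
case: (inner F d w k s) ni => [r r0|_ _|//]; last first.
  by rewrite gt0_muley ?lte_fin// leye_eq.
rewrite -!EFinM !lee_fin => h1 h2.
have h3 := ler_wpM2r (ltW B0) h1.
have h4 := ler_wpM2l (ltW C0) h2.
apply: (le_trans _ h4); apply: le_trans (le_trans h3 _);
  rewrite le_eqVlt; apply/orP; left; apply/eqP; ring.
Qed.

(** The norm in the direction d controls the two terms of the opposite
    direction: after [quasiconcave_bound], the inner norm is that of a weight
    decaying in the opposite direction, and so is the outer one; the remaining
    value b'(u) is at most a constant times the tail of b' ([pweight_le_tail]).
    The conditions on the exponents express the decay. *)
Lemma opposite_le E F E' F' d (lb hb lo hi lb' hb' lo' hi' : R) b w b' w' :
  pweight lb hb b -> pweight lo hi w -> pweight lb' hb' b' -> pweight lo' hi' w' ->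
  tnorm_on E (I (~~ d) 1%R) (EFin \o b) < +oo ->
  tnorm_on E' (I d 1%R) (EFin \o b') < +oo ->
  (if ~~ d then hi' - (lo + lb) < 0 else 0 < lo' - (hi + hb))%R ->
  (if ~~ d then hb' + (hi' - (lo + lb)) < 0 else 0 < lb' + (lo' - (hi + hb)))%R ->
  exists2 C, (0 < C)%R & forall k u, quasiconcave k -> (0 < u)%R ->
    tnorm_on E' (I (~~ d) u) (outer F' (~~ d) b' w' k) +
    tnorm_on E' (I d u) (EFin \o b') * inner F' (~~ d) w' k u <=
    (C * (w' u * tail E' d b' u * (w u * tail E (~~ d) b u)^-1))%:E *
      tnorm E (outer F d b w k).
Proof.
move=> pb pw pb' pw' fb fb' dec1 dec2.
pose v s := (w s * tail E (~~ d) b s)^-1%R.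
have pv := pweightV (pweightM pw (pweight_tail pb fb)).
have pw'v := pweightM pw' pv.
have pb'w'v := pweightM pb' pw'v.
have [C1 C10 H1] := quasiconcave_bound F pb pw fb.
have [C2 C20 H2] := tnorm_pweight_le F' dec1 pw'v.
have [C3 C30 H3] := tnorm_pweight_le E' dec2 pb'w'v.
have [C4 C40 H4] := pweight_le_tail pb' fb'.
have [wb b0 _] := pb; have [ww w0 _] := pw.
have [wb' b0' _] := pb'; have [ww' w0' _] := pw'.
have [wv v0 _] := pv.
have [ww'v w'v0 _] := pw'v; have [wb'w'v b'w'v0 _] := pb'w'v.
have C0 : (0 < C1 * C2 * (C3 * C4 + 1))%R.
  by rewrite !mulr_gt0 ?addr_gt0 ?mulr_gt0.
exists (C1 * C2 * (C3 * C4 + 1))%R; [exact: C0|move=> k u qk u0].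
have T0 := tail_gt0 pb' fb' u0.
have X0 : (0 < w' u * tail E' d b' u * (w u * tail E (~~ d) b u)^-1)%R.
  by apply: mulr_gt0; [apply: mulr_gt0; [exact: w0'|exact: T0]|exact: v0].
have no := nneg_meas_outer F d wb ww qk.1.
have := tnorm_ge0 E no; case mE : (tnorm E (outer F d b w k)) => [m| |] //; last first.
  move=> _; rewrite gt0_muley; first exact: leey.
  by rewrite lte_fin; apply: mulr_gt0.
rewrite lee_fin => m0.
have kle := H1 k m qk mE.
have nw'v := nneg_meas_weight ww'v.
have nw'k : nneg_meas (EFin \o (fun s => w' s * k s)%R).
  by apply: nneg_meas_weight; apply: weightM => //; exact: qk.1.
have C1m : (0 <= C1 * m)%R by rewrite mulr_ge0 ?(ltW C10).
have inner'_le t : (0 < t)%R ->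
    inner F' (~~ d) w' k t <= (C1 * m * (C2 * (w' t * v t)))%:E.
  move=> t0; rewrite EFinM; apply: (@le_trans _ _
      ((C1 * m)%:E * tnorm_on F' (I (~~ d) t) (EFin \o (fun s => w' s * v s)%R))).
    rewrite -(tnorm_on_scale F' _ C1m nw'v); apply: tnorm_on_le.
    - exact: nw'k.
    - by apply: nneg_measM; [exact: nneg_meas_cst|exact: nw'v].
    move=> s s0 _; rewrite /= -EFinM lee_fin mulrCA.
    by apply: ler_wpM2l; [apply ww'.2|exact: kle].
  by apply: lee_wpmul2l; [rewrite lee_fin|exact: H2].
have bw := H4 u u0.
rewrite (tailE pb' fb' u0) -EFinM.
apply: (@le_trans _ _ ((C1 * C2 * m * (C3 * (b' u * (w' u * v u))))%:E +
    (tail E' d b' u * (C1 * m * (C2 * (w' u * v u))))%:E)).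
  apply: leeD; last first.
    by rewrite EFinM; apply: lee_wpmul2l; [rewrite lee_fin; exact: ltW|exact: inner'_le].
  have C12m : (0 <= C1 * C2 * m)%R by rewrite !mulr_ge0 ?(ltW C10) ?(ltW C20).
  rewrite EFinM; apply: (@le_trans _ _ ((C1 * C2 * m)%:E *
      tnorm_on E' (I (~~ d) u) (EFin \o (fun s => b' s * (w' s * v s))%R))); last first.
    by apply: lee_wpmul2l; [rewrite lee_fin|exact: H3].
  have nbwv := nneg_meas_weight wb'w'v.
  rewrite -(tnorm_on_scale E' _ C12m nbwv); apply: tnorm_on_le.
  - by apply: nneg_meas_outer => //; exact: qk.1.
  - by apply: nneg_measM; [exact: nneg_meas_cst|exact: nbwv].
  move=> t t0 _; rewrite /outer.
  apply: (@le_trans _ _ ((b' t)%:E * (C1 * m * (C2 * (w' t * v t)))%:E)).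
    by apply: lee_wpmul2l; [rewrite lee_fin; exact/ltW/b0'|exact: inner'_le].
  rewrite /= -!EFinM lee_fin -/(v t) le_eqVlt; apply/orP; left; apply/eqP; ring.
have wv0 : (0 <= C1 * C2 * m * C3 * (w' u * v u))%R.
  rewrite !mulr_ge0 ?(ltW C10) ?(ltW C20) ?(ltW C30)//; apply: ltW; [exact: w0'|exact: v0].
rewrite -EFinD lee_fin -/(v u).
have h := ler_wpM2l wv0 bw.
apply: (@le_trans _ _ (C1 * C2 * m * C3 * (w' u * v u) * (C4 * tail E' d b' u) +
   tail E' d b' u * (C1 * m * (C2 * (w' u * v u))))%R).
  apply: lerD; last exact: lexx.
  by apply: le_trans h; rewrite le_eqVlt; apply/orP; left; apply/eqP; ring.
by rewrite le_eqVlt; apply/orP; left; apply/eqP; ring.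
Qed.

End opposite.

(** * The K-functional of a compatible couple *)

Section K_functional.
Context {R : realType} {V : topologicalLmodType R}.
Context (X0 X1 : nspace V R).
Hypothesis cX : compatible_couple X0 X1.
Local Notation K := (Kfun X0 X1).

Let q0 : quasi_banach X0. Proof. by case: cX => _ []. Qed.
Let q1 : quasi_banach X1. Proof. by case: cX => _ _ []. Qed.

Lemma qb_add (Y : nspace V R) x y : quasi_banach Y ->
  carrier Y x -> carrier Y y -> carrier Y (x + y)%R.
Proof. by move=> q cx cy; have := qb_lin q 1%R cx cy; rewrite scale1r. Qed.

Lemma qb_opp (Y : nspace V R) x : quasi_banach Y ->
  carrier Y x -> carrier Y (- x)%R /\ nnorm Y (- x)%R = nnorm Y x.
Proof.
move=> q cx; split.
  by have := qb_lin q (-1)%R cx (qb_0 q); rewrite scaleN1r addr0.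
by have := qb_scale q (-1)%R cx; rewrite scaleN1r normrN1 mul1e.
Qed.

Lemma qb_ge0 (Y : nspace V R) x : quasi_banach Y -> carrier Y x -> 0 <= nnorm Y x.
Proof. by move=> q /(qb_fin q)/andP[]. Qed.

Lemma qb_norm0 (Y : nspace V R) : quasi_banach Y -> nnorm Y 0%R = 0.
Proof.
by move=> q; have := qb_scale q 0%R (qb_0 q); rewrite scale0r normr0 mul0e.
Qed.

Lemma Kfun_ge0 s f : (0 < s)%R -> 0 <= K s f.
Proof.
move=> s0; apply/ereal_infP => _ [f0 [f1 [c0 c1 _ ->]]].
by rewrite adde_ge0 ?mule_ge0 ?lee_fin ?(ltW s0) ?qb_ge0.
Qed.

Lemma Kfun_le s f0 f1 : carrier X0 f0 -> carrier X1 f1 ->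
  K s (f0 + f1)%R <= nnorm X0 f0 + s%:E * nnorm X1 f1.
Proof. by move=> c0 c1; apply: ereal_inf_lbound; exists f0, f1. Qed.

Lemma Kfun_le0 s f0 : carrier X0 f0 -> K s f0 <= nnorm X0 f0.
Proof.
move=> c0; have := Kfun_le s c0 (qb_0 q1).
by rewrite addr0 qb_norm0// mule0 adde0.
Qed.

Lemma Kfun_le1 s f1 : carrier X1 f1 -> K s f1 <= s%:E * nnorm X1 f1.
Proof.
move=> c1; have := Kfun_le s (qb_0 q0) c1.
by rewrite add0r qb_norm0// add0e.
Qed.

Lemma Kfun_fin s f : (0 < s)%R -> sum_space X0 X1 f -> K s f \is a fin_num.
Proof.
move=> s0 [f0 [f1 [c0 c1 ->]]]; rewrite ge0_fin_numE ?Kfun_ge0//.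
apply: le_lt_trans (Kfun_le _ c0 c1) _.
have /andP[p0 l0] := qb_fin q0 c0; have /andP[p1 l1] := qb_fin q1 c1.
by rewrite lte_add_pinfty// lte_mul_pinfty// lee_fin ltW.
Qed.

Lemma Kfun_nd s t f : (0 < s)%R -> (s <= t)%R -> K s f <= K t f.
Proof.
move=> s0 st; apply/ereal_infP => _ [f0 [f1 [c0 c1 -> ->]]].
apply: le_trans (Kfun_le _ c0 c1) _.
by apply: leeD => //; apply: lee_wpmul2r; rewrite ?qb_ge0 ?lee_fin.
Qed.

Lemma Kfun_ratio s t f : (0 < s)%R -> (s <= t)%R -> K t f <= (t / s)%:E * K s f.
Proof.
move=> s0 st; have t0 : (0 < t)%R by exact: lt_le_trans st.
rewrite -lee_pdivrMl ?divr_gt0//; apply/ereal_infP => _ [f0 [f1 [c0 c1 -> ->]]].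
rewrite lee_pdivrMl ?divr_gt0//; apply: le_trans (Kfun_le _ c0 c1) _.
have ts : (0 <= t / s)%R by rewrite divr_ge0 ?(ltW t0) ?(ltW s0).
rewrite ge0_muleDr ?mule_ge0 ?qb_ge0 ?lee_fin ?(ltW s0)//.
apply: leeD; last by rewrite muleA -EFinM divfK ?gt_eqF.
rewrite -[leLHS]mul1e; apply: lee_wpmul2r; first exact: qb_ge0.
by rewrite lee_fin ler_pdivlMr// mul1r.
Qed.

Definition kfun f (s : R) : R := fine (K s f).

Lemma kfunE f s : sum_space X0 X1 f -> (0 < s)%R -> K s f = (kfun f s)%:E.
Proof. by move=> Xf s0; rewrite fineK// Kfun_fin. Qed.

Lemma quasiconcave_kfun f : sum_space X0 X1 f -> quasiconcave (kfun f).
Proof.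
move=> Xf; split.
  split; last by move=> s s0; rewrite fine_ge0// Kfun_ge0.
  have [mK _] : nneg_meas (fun s => K s f).
    by apply: nneg_meas_nd => [s|s t]; [exact: Kfun_ge0|exact: Kfun_nd].
  exact: (measurableT_comp (@fine_measurable R setT measurableT) mK).
move=> s t s0 st; have t0 : (0 < t)%R by exact: lt_le_trans st.
rewrite powRr1 ?divr_ge0 ?(ltW s0) ?(ltW t0)// powRr0 !mul1r -!lee_fin EFinM.
by rewrite -!kfunE// Kfun_ratio// Kfun_nd.
Qed.

(** Add nearly optimal decompositions of f and g. *)
Lemma Kfun_add : exists2 C : R, (0 < C)%R & forall s f g, (0 < s)%R ->
  sum_space X0 X1 f -> sum_space X0 X1 g ->
  sum_space X0 X1 (f + g)%R /\ K s (f + g)%R <= C%:E * (K s f + K s g).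
Proof.
have [C0 H0] := qb_quasi_triangle q0; have [C1 H1] := qb_quasi_triangle q1.
pose C := Num.max 1%R (Num.max C0 C1).
have C1' : (1 <= C)%R by rewrite le_max lexx.
have C_gt0 : (0 < C)%R by exact: lt_le_trans C1'.
have CC0 : (C0 <= C)%R by rewrite !le_max lexx orbT.
have CC1 : (C1 <= C)%R by rewrite !le_max lexx !orbT.
exists C => // s f g s0 Xf Xg; split.
  move: Xf Xg => [f0 [f1 [cf0 cf1 ->]]] [g0 [g1 [cg0 cg1 ->]]].
  by exists (f0 + g0)%R, (f1 + g1)%R; split; [exact: qb_add|exact: qb_add|rewrite addrACA].
have Kf := Kfun_fin s0 Xf; have Kg := Kfun_fin s0 Xg.
rewrite -lee_pdivrMl//.
apply/lee_addgt0Pr => e e0.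
have e20 : (0 < e / 2)%R by rewrite divr_gt0.
have [_ [f0 [f1 [cf0 cf1 fE ->]]] lf] := lb_ereal_inf_adherent e20 Kf.
have [_ [g0 [g1 [cg0 cg1 gE ->]]] lg] := lb_ereal_inf_adherent e20 Kg.
have -> : K s f + K s g + e%:E = (K s f + (e / 2)%:E) + (K s g + (e / 2)%:E).
  by rewrite addeACA -EFinD -splitr.
apply: le_trans (leeD (ltW lf) (ltW lg)).
rewrite lee_pdivrMl// fE gE addrACA.
apply: le_trans (Kfun_le _ (qb_add q0 cf0 cg0) (qb_add q1 cf1 cg1)) _.
have pf0 := qb_ge0 q0 cf0; have pg0 := qb_ge0 q0 cg0.
have pf1 := qb_ge0 q1 cf1; have pg1 := qb_ge0 q1 cg1.
have s0' : (0 <= s)%R by exact: ltW.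
have h0 : nnorm X0 (f0 + g0)%R <= C%:E * (nnorm X0 f0 + nnorm X0 g0).
  apply: le_trans (H0 _ _ cf0 cg0) _.
  by apply: lee_wpmul2r; rewrite ?adde_ge0 ?lee_fin.
have h1 : nnorm X1 (f1 + g1)%R <= C%:E * (nnorm X1 f1 + nnorm X1 g1).
  apply: le_trans (H1 _ _ cf1 cg1) _.
  by apply: lee_wpmul2r; rewrite ?adde_ge0 ?lee_fin.
rewrite addeACA (_ : s%:E * nnorm X1 f1 + s%:E * nnorm X1 g1 =
  s%:E * (nnorm X1 f1 + nnorm X1 g1)); last by rewrite ge0_muleDr.
rewrite ge0_muleDr; [|exact: adde_ge0|]; last first.
  by apply: mule_ge0; [rewrite lee_fin|exact: adde_ge0].
apply: leeD; first exact: h0.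
by rewrite muleCA; apply: lee_wpmul2l; [rewrite lee_fin|exact: h1].
Qed.

(** If K(s, f) = 0, then f = f0 + f1 with both parts arbitrarily small in the
    ambient space, so f lies in every neighborhood of 0. *)
Lemma Kfun_eq0 s f : (0 < s)%R -> sum_space X0 X1 f -> K s f = 0 -> f = 0%R.
Proof.
move=> s0 Xf K0; have [hV [_ e0] [_ e1]] := cX.
apply/esym; apply: hV => A B A0 Bf.
have [[U1 U2] /= [nU1 nU2] UA] : nbhs ((0, 0)%R : V * V) [set z | A (z.1 + z.2)%R].
  by apply: (@add_continuous V (0, 0)%R); rewrite /= addr0.
have [d1 d10 H1] := e0 _ nU1; have [d2 d20 H2] := e1 _ nU2.
pose d := Num.min d1 (s * d2)%R.
have d0 : (0 < d)%R by rewrite lt_min d10 mulr_gt0.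
have := lb_ereal_inf_adherent d0 (Kfun_fin s0 Xf).
rewrite -/(K s f) K0 add0e => -[_ [f0 [f1 [c0 c1 fE ->]]] lt].
exists f; split; last exact: nbhs_singleton.
rewrite fE; apply: (UA (f0, f1)); split => /=.
  apply: H1 => //; apply: le_lt_trans (lt_le_trans lt _).
    by rewrite leeDl// mule_ge0 ?qb_ge0 ?lee_fin ?ltW.
  by rewrite lee_fin ge_min lexx.
apply: H2 => //; rewrite -(@lte_pmul2l _ s%:E) ?lte_fin// -EFinM.
apply: le_lt_trans (lt_le_trans lt _).
  by rewrite leeDr// qb_ge0.
by rewrite lee_fin ge_min lexx orbT.
Qed.

(** For a decomposition f = f0 + f1 with |f0| + u |f1| <= 2 K(u, f), the bounds
    of K(s, f0) by |f0| and of K(s, f1) by s |f1| serve on one side of u, and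
    the quasi-triangle inequality for f0 = f - f1 and f1 = f - f0 on the other.
    If K(u, f) = 0 no strict inequality is available, but then f = 0. *)
Lemma Kfun_decomposition : exists2 C : R, (0 < C)%R &
  forall u f, (0 < u)%R -> sum_space X0 X1 f -> exists f0 f1 : V,
    [/\ carrier X0 f0, carrier X1 f1, f = (f0 + f1)%R,
     forall s, (0 < s)%R ->
       (s <= u)%R -> (kfun f0 s <= C * kfun f s)%R /\
                     (kfun f1 s <= C * (s * (kfun f u / u)))%R &
     forall s, (0 < s)%R ->
       (u <= s)%R -> (kfun f0 s <= C * kfun f u)%R /\
                     (kfun f1 s <= C * kfun f s)%R].
Proof.
have [C C0 H] := Kfun_add; exists (C * 3 + 2)%R; first by rewrite addr_gt0 ?mulr_gt0.
move=> u f u0 Xf.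
have [ww gg] := quasiconcave_kfun Xf.
have ku0 : (0 <= kfun f u)%R by apply ww.2.
have [f0 [f1 [c0 c1 fE lef]]] : exists f0 f1, [/\ carrier X0 f0, carrier X1 f1,
    f = (f0 + f1)%R & nnorm X0 f0 + u%:E * nnorm X1 f1 <= (2 * kfun f u)%:E].
  move: ku0; rewrite le_eqVlt => /predU1P[k0|k0].
    exists 0%R, 0%R; split; [exact: qb_0|exact: qb_0| |].
      by rewrite addr0; apply: (Kfun_eq0 u0 Xf); rewrite kfunE// -k0.
    by rewrite !qb_norm0// mule0 adde0 -k0 mulr0.
  have [_ [f0 [f1 [c0 c1 fE ->]]] lf] := lb_ereal_inf_adherent k0 (Kfun_fin u0 Xf).
  exists f0, f1; split => //; apply: (le_trans (ltW lf)).
  by rewrite -/(K u f) kfunE// -EFinD lee_fin mulr2n mulrDl mul1r.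
have S0 : sum_space X0 X1 f0 by exists f0, 0%R; rewrite addr0; split => //; exact: qb_0.
have S1 : sum_space X0 X1 f1 by exists 0%R, f1; rewrite add0r; split => //; exact: qb_0.
have [c0' n0'] := qb_opp q0 c0; have [c1' n1'] := qb_opp q1 c1.
have S0' : sum_space X0 X1 (- f0)%R by exists (- f0)%R, 0%R; rewrite addr0; split => //; exact: qb_0.
have S1' : sum_space X0 X1 (- f1)%R by exists 0%R, (- f1)%R; rewrite add0r; split => //; exact: qb_0.
have /andP[p0 l0] := qb_fin q0 c0; have /andP[p1 l1] := qb_fin q1 c1.
have [r0 r0E] : exists r, nnorm X0 f0 = r%:E.
  by exists (fine (nnorm X0 f0)); rewrite fineK// ge0_fin_numE.
have [r1 r1E] : exists r, nnorm X1 f1 = r%:E.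
  by exists (fine (nnorm X1 f1)); rewrite fineK// ge0_fin_numE.
rewrite r0E lee_fin in p0; rewrite r1E lee_fin in p1.
move: lef; rewrite r0E r1E -EFinM -EFinD lee_fin => lef.
have ur1 : (0 <= u * r1)%R by rewrite mulr_ge0 ?(ltW u0).
have B0 s : (0 < s)%R -> (kfun f0 s <= r0)%R.
  by move=> s0; rewrite -lee_fin -kfunE// -r0E; exact: Kfun_le0.
have B1 s : (0 < s)%R -> (kfun f1 s <= s * r1)%R.
  by move=> s0; rewrite -lee_fin -kfunE// EFinM -r1E; exact: Kfun_le1.
have D0 s : (0 < s)%R -> (kfun f0 s <= C * (kfun f s + s * r1))%R.
  move=> s0; have [_ h] := H s f (- f1)%R s0 Xf S1'.
  have E0 : (f + - f1 = f0)%R by rewrite fE addrK.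
  rewrite E0 kfunE// kfunE// in h; rewrite -lee_fin; apply: (le_trans h).
  rewrite EFinM lee_pmul2l ?lte_fin// EFinD; apply: leeD => //.
  by rewrite EFinM -r1E -n1'; exact: Kfun_le1.
have D1 s : (0 < s)%R -> (kfun f1 s <= C * (kfun f s + r0))%R.
  move=> s0; have [_ h] := H s f (- f0)%R s0 Xf S0'.
  have E1 : (f + - f0 = f1)%R by rewrite fE addrAC subrr add0r.
  rewrite E1 kfunE// kfunE// in h; rewrite -lee_fin; apply: (le_trans h).
  rewrite EFinM lee_pmul2l ?lte_fin// EFinD; apply: leeD => //.
  by rewrite -r0E -n0'; exact: Kfun_le0.
have r0le : (r0 <= 2 * kfun f u)%R by lra.
have r1le : (r1 <= 2 * (kfun f u / u))%R by rewrite mulrA ler_pdivlMr// mulrC; lra.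
exists f0, f1; split => // s s0 su; have ks : (0 <= kfun f s)%R by apply ww.2.
- have kr : (s * (kfun f u / u) <= kfun f s)%R.
    have [h _] := gg s u s0 su; rewrite mul1r powRr1 ?divr_ge0 ?(ltW u0) ?(ltW s0)// in h.
    rewrite mulrA ler_pdivrMr//; apply: (le_trans (ler_wpM2l (ltW s0) h)).
    by rewrite le_eqVlt; apply/orP; left; apply/eqP; field; rewrite gt_eqF.
  have kr0 : (0 <= s * (kfun f u / u))%R by rewrite mulr_ge0 ?divr_ge0 ?(ltW s0) ?(ltW u0).
  have sr1 : (s * r1 <= 2 * (s * (kfun f u / u)))%R by rewrite mulrCA ler_pM2l.
  split.
    apply: (le_trans (D0 s s0)); apply: (@le_trans _ _ (C * (kfun f s * 3))%R).
      by rewrite ler_pM2l//; lra.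
    by rewrite mulrDl -!mulrA (mulrC 3%R) lerDl mulr_ge0.
  apply: (le_trans (B1 s s0)); apply: (le_trans sr1).
  by rewrite ler_wpM2r// lerDr mulr_ge0// ltW.
have kk : (kfun f u <= kfun f s)%R.
  by have [_ h] := gg u s u0 su; rewrite powRr0 !mul1r in h.
split.
  apply: (le_trans (B0 s s0)); apply: (le_trans r0le).
  by rewrite ler_wpM2r// lerDr mulr_ge0// ltW.
apply: (le_trans (D1 s s0)); apply: (@le_trans _ _ (C * (kfun f s * 3))%R).
  by rewrite ler_pM2l//; lra.
by rewrite mulrDl -!mulrA (mulrC 3%R) lerDl mulr_ge0.
Qed.

End K_functional.

Section split_norm.
Context {R : realType}.
Local Notation I d u := [set` idir d u].
Implicit Types (E F : riSpace R) (d : bool) (b w k : R -> R).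

(** The two terms of the formula that belong to one of the spaces: the full norm
    with the inner norm stopped at u when the outer variable is on the far side.
    For the direction true they are to be multiplied by rho(u). *)
Definition split_norm E F d b w k (u : R) : \bar R :=
  tnorm_on E (I d u) (outer F d b w k) +
  tnorm_on E (I (~~ d) u) (EFin \o b) * inner F d w k u.

Lemma split_norm_ge0 E F d b w k u : weight b -> weight w -> weight k ->
  (0 < u)%R -> 0 <= split_norm E F d b w k u.
Proof.
move=> wb ww wk u0; apply: adde_ge0.
  by apply: tnorm_on_ge0; exact: nneg_meas_outer.
apply: mule_ge0; first by apply: tnorm_on_ge0; exact: nneg_meas_weight.
by apply (nneg_meas_inner F d ww wk).
Qed.

Lemma split_norm_le_outer E F d b w k (B u : R) : weight b -> weight w -> weight k ->
  (0 < u)%R -> tnorm_on E (I (~~ d) u) (EFin \o b) = B%:E ->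
  split_norm E F d b w k u <= 2%:E * tnorm E (outer F d b w k).
Proof.
move=> wb ww wk u0 BE.
have -> : 2%:E * tnorm E (outer F d b w k) =
    tnorm E (outer F d b w k) + tnorm E (outer F d b w k).
  by rewrite mule_natl mule2n.
apply: leeD; first exact: local_le_outer.
exact: tail_inner_le_outer BE.
Qed.

Lemma split_norm_add E F d b w k k1 k2 (C u : R) :
  weight b -> weight w -> weight k -> weight k1 -> weight k2 ->
  (0 < C)%R -> (0 < u)%R -> (forall s, (0 < s)%R -> (k s <= C * (k1 s + k2 s))%R) ->
  split_norm E F d b w k u <=
    C%:E * (split_norm E F d b w k1 u + split_norm E F d b w k2 u).
Proof.
move=> wb ww wk wk1 wk2 C0 u0 kle.
have nb := nneg_meas_weight wb.
have ni := nneg_meas_inner F d ww.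
have no := nneg_meas_outer F d wb ww.
have nw k' : weight k' -> nneg_meas (EFin \o (fun s => w s * k' s)%R).
  by move=> wk'; apply: nneg_meas_weight; exact: weightM.
have C0' := ltW C0.
have inn t : (0 < t)%R -> inner F d w k t <=
    C%:E * (inner F d w k1 t + inner F d w k2 t).
  move=> t0; have nD := nneg_measD (nw _ wk1) (nw _ wk2).
  apply: (@le_trans _ _ (C%:E * tnorm_on F (I d t) (fun s =>
     (EFin \o (fun s => w s * k1 s)%R) s + (EFin \o (fun s => w s * k2 s)%R) s))).
    rewrite -(tnorm_on_scale F _ C0' nD); apply: tnorm_on_le; first exact: nw.
      by apply: nneg_measM; [exact: nneg_meas_cst|exact: nD].
    move=> s s0 _; rewrite /= -EFinD -EFinM lee_fin -mulrDr mulrCA.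
    by apply: ler_wpM2l; [apply ww.2|exact: kle].
  apply: lee_wpmul2l; first by rewrite lee_fin.
  by apply: tnorm_on_add; exact: nw.
have out : tnorm_on E (I d u) (outer F d b w k) <= C%:E *
    (tnorm_on E (I d u) (outer F d b w k1) + tnorm_on E (I d u) (outer F d b w k2)).
  have nD := nneg_measD (no _ wk1) (no _ wk2).
  apply: (@le_trans _ _ (C%:E * tnorm_on E (I d u) (fun t =>
     outer F d b w k1 t + outer F d b w k2 t))).
    rewrite -(tnorm_on_scale E _ C0' nD); apply: tnorm_on_le; first exact: no.
      by apply: nneg_measM; [exact: nneg_meas_cst|exact: nD].
    move=> t t0 _; rewrite /outer.
    have i1 := (ni _ wk1).2 t t0; have i2 := (ni _ wk2).2 t t0.
    rewrite -(ge0_muleDr _ i1 i2) muleCA; apply: lee_wpmul2l; first by apply nb.2.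
    exact: inn.
  apply: lee_wpmul2l; first by rewrite lee_fin.
  by apply: tnorm_on_add; exact: no.
have i1 := (ni _ wk1).2 u u0; have i2 := (ni _ wk2).2 u u0.
have o1 : 0 <= tnorm_on E (I d u) (outer F d b w k1).
  by apply: tnorm_on_ge0; exact: no.
have o2 : 0 <= tnorm_on E (I d u) (outer F d b w k2).
  by apply: tnorm_on_ge0; exact: no.
have B0 : 0 <= tnorm_on E (I (~~ d) u) (EFin \o b) by exact: tnorm_on_ge0.
rewrite /split_norm addeACA -(ge0_muleDr _ i1 i2).
rewrite (ge0_muleDr _ (adde_ge0 o1 o2) (mule_ge0 B0 (adde_ge0 i1 i2))).
apply: leeD; first exact: out.
by rewrite muleCA; apply: lee_wpmul2l; [exact: B0|exact: inn].
Qed.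

End split_norm.

Section norms.
Context {R : realType} {V : topologicalLmodType R}.
Context (X0 X1 : nspace V R).
Hypothesis cX : compatible_couple X0 X1.
Implicit Types (E F : riSpace R) (d : bool) (a b : R -> R).
Local Notation kfun := (kfun X0 X1).

Definition wpow (theta : R) (a : R -> R) (s : R) : R := (s `^ (- theta) * a s)%R.

Lemma pweight_wpow (theta e : R) a : SV a -> (0 < e)%R ->
  pweight (- theta - e) (- theta + e) (wpow theta a).
Proof.
by move=> sva e0; exact: (pweightM (pweight_pow (- theta)) (pweight_SV sva e0)).
Qed.

Lemma innerE F d theta a f t : sum_space X0 X1 f ->
  tnorm_on F [set` idir d t] (wK X0 X1 theta a f) = inner F d (wpow theta a) (kfun f) t.
Proof.
by move=> Xf; apply: tnorm_on_eq => x x0 _; rewrite /wK (kfunE cX)// -EFinM.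
Qed.

Lemma outerE F d theta a b f : sum_space X0 X1 f ->
  (fun t => (b t)%:E * tnorm_on F [set` idir d t] (wK X0 X1 theta a f)) =
  outer F d b (wpow theta a) (kfun f).
Proof. by move=> Xf; apply/funext => t; rewrite innerE. Qed.

End norms.

(** * The equivalence *)

(** The norm of one part f' of a decomposition of f. On the far side of u its
    K-functional is at most a constant times K(u, f) (s/u)^shift, with shift = 0
    for f0 and 1 for f1; the decay of w(s) s^shift gives the condition of
    [outer_le]. *)
Lemma decomposition_outer_le (R : realType) (V : topologicalLmodType R)
    (X0 X1 : nspace V R) (E F : riSpace R) (d : bool) (lb hb lo hi : R)
    (b w : R -> R) (shift Cd : R) :
  compatible_couple X0 X1 -> pweight lb hb b -> pweight lo hi w ->
  tnorm_on E [set` idir (~~ d) 1%R] (EFin \o b) < +oo ->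
  (if ~~ d then hi + shift < 0 else 0 < lo + shift)%R -> (0 < Cd)%R ->
  exists2 C : R, (0 < C)%R & forall f f' u, (0 < u)%R ->
    sum_space X0 X1 f -> sum_space X0 X1 f' ->
    (forall s, (0 < s)%R -> s \in idir d u ->
       (kfun X0 X1 f' s <= Cd * kfun X0 X1 f s)%R) ->
    (forall s, (0 < s)%R -> s \in idir (~~ d) u ->
       (kfun X0 X1 f' s <= Cd * ((s / u) `^ shift * kfun X0 X1 f u))%R) ->
    tnorm E (outer F d b w (kfun X0 X1 f')) <=
      C%:E * split_norm E F d b w (kfun X0 X1 f) u.
Proof.
move=> cX pb pw fb dec Cd0.
have [wb _ _] := pb; have [ww w0 _] := pw.
have pws := pweightM pw (pweight_pow shift).
have [wws _ _] := pws.
have [C1 C10 H1] := tnorm_pweight_le F dec pws.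
have [C C0 H] := outer_le F wb pw (tailE pb fb) (tail_gt0 pb fb) Cd0 (mulr_gt0 Cd0 C10).
exists C; [exact: C0|move=> f f' u u0 Xf Xf' near far].
have qk := quasiconcave_kfun cX Xf; have qk' := quasiconcave_kfun cX Xf'.
have ku := qk.1.2 u u0.
apply: H; [exact: qk'.1|exact: qk|exact: u0|exact: near|].
have us0 : (0 < u `^ shift)%R by exact: powR_gt0.
have c0 : (0 <= Cd * kfun X0 X1 f u / u `^ shift)%R.
  by rewrite divr_ge0 ?mulr_ge0 ?(ltW Cd0) ?(ltW us0).
have nws := nneg_meas_weight wws.
apply: (@le_trans _ _ ((Cd * kfun X0 X1 f u / u `^ shift)%:E *
   tnorm_on F [set` idir (~~ d) u] (EFin \o (fun s => w s * s `^ shift)%R))).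
  rewrite -(tnorm_on_scale F _ c0 nws); apply: tnorm_on_le.
  - by apply: nneg_meas_weight; apply: weightM; [exact: ww|exact: qk'.1].
  - by apply: nneg_measM; [exact: nneg_meas_cst|exact: nws].
  move=> s s0 su; rewrite /= -EFinM lee_fin.
  apply: le_trans (ler_wpM2l (ltW (w0 s s0)) (far s s0 su)) _.
  rewrite powR_ratio// le_eqVlt; apply/orP; left; apply/eqP; field.
  by rewrite gt_eqF.
apply: le_trans (lee_wpmul2l _ (H1 u u0)) _; first by rewrite lee_fin.
rewrite -EFinM lee_fin le_eqVlt; apply/orP; left; apply/eqP; field.
by rewrite gt_eqF.
Qed.

Theorem theorem3p4 (R : realType) (V : topologicalLmodType R)
    (X0 X1 : nspace V R) (theta0 theta1 : R)
    (E0 E1 F0 F1 : riSpace R) (a0 a1 b0 b1 : R -> R) :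
  compatible_couple X0 X1 ->
  (0 < theta0)%R -> (theta0 < theta1)%R -> (theta1 < 1)%R ->
  SV a0 -> SV a1 -> SV b0 -> SV b1 ->
  tnorm_on E0 `]1%R, +oo[ (EFin \o b0) < +oo ->
  tnorm_on E1 `]0%R, 1%R[ (EFin \o b1) < +oo ->
  let YL := spaceL X0 X1 theta0 b0 E0 a0 F0 in
  let YR := spaceR X0 X1 theta1 b1 E1 a1 F1 in
  let rho := fun u : R =>
    (u `^ (theta1 - theta0) *
     ((a0 u * fine (tnorm_on E0 `]u, +oo[ (EFin \o b0))) /
      (a1 u * fine (tnorm_on E1 `]0%R, u[ (EFin \o b1)))))%R in
  let wK0 := wK X0 X1 theta0 a0 in
  let wK1 := wK X0 X1 theta1 a1 in
  let rhs := fun (f : V) (u : R) =>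
    tnorm_on E0 `]0%R, u[ (fun t => (b0 t)%:E * tnorm_on F0 `]0%R, t[ (wK0 f))
    + tnorm_on E0 `]u, +oo[ (EFin \o b0) * tnorm_on F0 `]0%R, u[ (wK0 f)
    + (rho u)%:E * tnorm_on E1 `]0%R, u[ (EFin \o b1)
      * tnorm_on F1 `]u, +oo[ (wK1 f)
    + (rho u)%:E *
      tnorm_on E1 `]u, +oo[
        (fun t => (b1 t)%:E * tnorm_on F1 `]t, +oo[ (wK1 f)) in
  exists2 c : R, (0 < c)%R &
    forall (f : V) (u : R), sum_space YL YR f -> (0 < u)%R ->
      Kfun YL YR (rho u) f <= c%:E * rhs f u /\
      rhs f u <= c%:E * Kfun YL YR (rho u) f.
Proof.
move=> cX th0 th01 th1 sva0 sva1 svb0 svb1 fb0 fb1 YL YR rho wK0 wK1 rhs.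
(* Each slowly varying factor costs an exponent e, and at most four of them
   occur in one weight; a fifth of each gap keeps the inequalities strict. *)
pose e := (Num.min (Num.min theta0 (1 - theta1)) (theta1 - theta0) / 5)%R.
have e0 : (0 < e)%R.
  by rewrite /e divr_gt0// !lt_min th0 !subr_gt0 th1 th01.
have e5 : (5 * e = Num.min (Num.min theta0 (1 - theta1)) (theta1 - theta0))%R.
  by rewrite /e mulrC divfK.
have eth0 : (5 * e <= theta0)%R by rewrite e5 !ge_min lexx.
have eth1 : (5 * e <= 1 - theta1)%R by rewrite e5 !ge_min lexx orbT.
have eth : (5 * e <= theta1 - theta0)%R by rewrite e5 !ge_min lexx orbT.
clear e5; clearbody e.
pose w0 := wpow theta0 a0; pose w1 := wpow theta1 a1.
have pw0 : pweight (- theta0 - e) (- theta0 + e) w0 by exact: pweight_wpow.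
have pw1 : pweight (- theta1 - e) (- theta1 + e) w1 by exact: pweight_wpow.
have pb0 := pweight_SV svb0 e0; have pb1 := pweight_SV svb1 e0.
pose B0 := tail E0 true b0; pose B1 := tail E1 false b1.
have B0E u : (0 < u)%R -> tnorm_on E0 [set` idir true u] (EFin \o b0) = (B0 u)%:E.
  by move=> u0; exact: (@tailE _ E0 true _ _ _ pb0 fb0).
have B1E u : (0 < u)%R -> tnorm_on E1 [set` idir false u] (EFin \o b1) = (B1 u)%:E.
  by move=> u0; exact: (@tailE _ E1 false _ _ _ pb1 fb1).
have B0p u : (0 < u)%R -> (0 < B0 u)%R.
  by move=> u0; exact: (@tail_gt0 _ E0 true _ _ _ pb0 fb0).
have B1p u : (0 < u)%R -> (0 < B1 u)%R.
  by move=> u0; exact: (@tail_gt0 _ E1 false _ _ _ pb1 fb1).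
have [wb0 _ _] := pb0; have [wb1 _ _] := pb1.
have [ww0 w0p _] := pw0; have [ww1 w1p _] := pw1.
have rhoE u : (0 < u)%R -> rho u = (w0 u * B0 u * (w1 u * B1 u)^-1)%R.
  move=> u0; have -> : rho u = (u `^ (theta1 - theta0) *
    ((a0 u * B0 u) / (a1 u * B1 u)))%R by [].
  rewrite /w0 /w1 /wpow !powRN.
  have := B0p u u0; have := B1p u u0; move: (B0 u) (B1 u) => x y y0 x0.
  have a1p : (0 < a1 u)%R by case: sva1 => _ + _; apply.
  have p0 := powR_gt0 theta0 u0; have p1 := powR_gt0 theta1 u0.
  rewrite powRB; last by rewrite (gt_eqF u0) implybT.
  by field; rewrite !gt_eqF.
have rho0 u : (0 < u)%R -> (0 < rho u)%R.
  move=> u0; rewrite rhoE; last exact: u0.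
  apply: mulr_gt0; first by apply: mulr_gt0; [exact: w0p|exact: B0p].
  by rewrite invr_gt0; apply: mulr_gt0; [exact: w1p|exact: B1p].
pose k := kfun X0 X1.
have qk f : sum_space X0 X1 f -> quasiconcave (k f) := @quasiconcave_kfun _ _ _ _ cX f.
pose S0 f u := split_norm E0 F0 false b0 w0 (k f) u.
pose S1 f u := split_norm E1 F1 true b1 w1 (k f) u.
pose N0 f := tnorm E0 (outer F0 false b0 w0 (k f)).
pose N1 f := tnorm E1 (outer F1 true b1 w1 (k f)).
have N0E f : sum_space X0 X1 f -> nnorm YL f = N0 f.
  by move=> Xf; rewrite /N0 -(outerE cX F0 false theta0 a0 b0 Xf).
have N1E f : sum_space X0 X1 f -> nnorm YR f = N1 f.
  by move=> Xf; rewrite /N1 -(outerE cX F1 true theta1 a1 b1 Xf).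
have YLP f : carrier YL f <-> sum_space X0 X1 f /\ N0 f < +oo.
  by split=> -[Xf fin]; split; [exact: Xf|rewrite -N0E|exact: Xf|move: fin; rewrite -N0E].
have YRP f : carrier YR f <-> sum_space X0 X1 f /\ N1 f < +oo.
  by split=> -[Xf fin]; split; [exact: Xf|rewrite -N1E|exact: Xf|move: fin; rewrite -N1E].
have S0_ge0 f u : sum_space X0 X1 f -> (0 < u)%R -> 0 <= S0 f u.
  by move=> Xf u0; apply: split_norm_ge0; [exact: wb0|exact: ww0|exact: (qk f Xf).1|exact: u0].
have S1_ge0 f u : sum_space X0 X1 f -> (0 < u)%R -> 0 <= S1 f u.
  by move=> Xf u0; apply: split_norm_ge0; [exact: wb1|exact: ww1|exact: (qk f Xf).1|exact: u0].
have N0_ge0 f : sum_space X0 X1 f -> 0 <= N0 f.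
  by move=> Xf; apply: tnorm_ge0; apply: nneg_meas_outer; [exact: wb0|exact: ww0|exact: (qk f Xf).1].
have N1_ge0 f : sum_space X0 X1 f -> 0 <= N1 f.
  by move=> Xf; apply: tnorm_ge0; apply: nneg_meas_outer; [exact: wb1|exact: ww1|exact: (qk f Xf).1].
have rhsE f u : sum_space X0 X1 f -> (0 < u)%R ->
    rhs f u = S0 f u + (rho u)%:E * S1 f u.
  move=> Xf u0; rewrite /rhs /S0 /S1 /split_norm.
  rewrite -(innerE cX F0 false theta0 a0 u Xf) -(innerE cX F1 true theta1 a1 u Xf).
  rewrite -(outerE cX F0 false theta0 a0 b0 Xf) -(outerE cX F1 true theta1 a1 b1 Xf).
  have no1 : nneg_meas (fun t => (b1 t)%:E * tnorm_on F1 [set` idir true t] (wK X0 X1 theta1 a1 f)).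
    rewrite (outerE cX F1 true theta1 a1 b1 Xf).
    by apply: nneg_meas_outer; [exact: wb1|exact: ww1|exact: (qk f Xf).1].
  have i1 : 0 <= tnorm_on F1 [set` idir true u] (wK X0 X1 theta1 a1 f).
    rewrite (innerE cX F1 true theta1 a1 u Xf).
    by apply (nneg_meas_inner F1 true ww1 (qk f Xf).1).
  rewrite [X in _ = _ + X]ge0_muleDr; last 2 first.
  - by apply: tnorm_on_ge0; exact: no1.
  - apply: mule_ge0; last exact: i1.
    by apply: tnorm_on_ge0; exact: nneg_meas_weight.
  by rewrite [X in _ = _ + X]addeC addeA muleA.
have [Cd Cd0 Hd] := Kfun_decomposition cX.
have [Ca Ca0 Ha] := Kfun_add cX.
(* Norms of the two parts of a nearly optimal decomposition. *)
have [U0 U00 HU0] : exists2 C : R, (0 < C)%R & forall f f' u, (0 < u)%R ->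
    sum_space X0 X1 f -> sum_space X0 X1 f' ->
    (forall s, (0 < s)%R -> s \in idir false u -> (k f' s <= Cd * k f s)%R) ->
    (forall s, (0 < s)%R -> s \in idir true u ->
       (k f' s <= Cd * ((s / u) `^ 0 * k f u))%R) ->
    N0 f' <= C%:E * S0 f u.
  apply: (decomposition_outer_le F0 cX pb0 pw0); [exact: fb0| |exact: Cd0].
  by rewrite /=; lra.
have [U1 U10 HU1] : exists2 C : R, (0 < C)%R & forall f f' u, (0 < u)%R ->
    sum_space X0 X1 f -> sum_space X0 X1 f' ->
    (forall s, (0 < s)%R -> s \in idir true u -> (k f' s <= Cd * k f s)%R) ->
    (forall s, (0 < s)%R -> s \in idir false u ->
       (k f' s <= Cd * ((s / u) `^ 1 * k f u))%R) ->
    N1 f' <= C%:E * S1 f u.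
  apply: (decomposition_outer_le F1 cX pb1 pw1); [exact: fb1| |exact: Cd0].
  by rewrite /=; lra.
(* The terms of each space at an element of the other one; rho u cancels the
   ratio of weights and tails produced by [opposite_le]. *)
have [M1 M1_gt0 HM1] : exists2 C : R, (0 < C)%R & forall f u, sum_space X0 X1 f ->
    (0 < u)%R -> (rho u)%:E * S1 f u <= C%:E * N0 f.
  have d1 : (- theta1 + e - (- theta0 - e + - e) < 0)%R by lra.
  have d2 : (e + (- theta1 + e - (- theta0 - e + - e)) < 0)%R by lra.
  have [C C0 H] := @opposite_le _ E0 F0 E1 F1 false _ _ _ _ _ _ _ _ b0 w0 b1 w1
    pb0 pw0 pb1 pw1 fb0 fb1 d1 d2.
  exists C; [exact: C0|move=> f u Xf u0].
  have ru : 0 <= (rho u)%:E by rewrite lee_fin; apply: ltW; exact: rho0.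
  apply: le_trans (lee_wpmul2l ru (H _ u (qk f Xf) u0)) _.
  rewrite muleA -EFinM rhoE; last exact: u0.
  rewrite le_eqVlt; apply/orP; left; apply/eqP; congr (_%:E * _).
  rewrite -/(B0 u) -/(B1 u); field.
  by rewrite (gt_eqF (B0p u u0)) (gt_eqF (B1p u u0)) (gt_eqF (w0p u u0)) (gt_eqF (w1p u u0)).
have [M0 M0_gt0 HM0] : exists2 C : R, (0 < C)%R & forall f u, sum_space X0 X1 f ->
    (0 < u)%R -> S0 f u <= (C * rho u)%:E * N1 f.
  have d1 : (0 < - theta0 - e - (- theta1 + e + e))%R by lra.
  have d2 : (0 < - e + (- theta0 - e - (- theta1 + e + e)))%R by lra.
  have [C C0 H] := @opposite_le _ E1 F1 E0 F0 true _ _ _ _ _ _ _ _ b1 w1 b0 w0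
    pb1 pw1 pb0 pw0 fb1 fb0 d1 d2.
  exists C; [exact: C0|move=> f u Xf u0].
  by rewrite rhoE; [exact: (H _ u (qk f Xf) u0)|exact: u0].
have S0_add f g u : sum_space X0 X1 f -> sum_space X0 X1 g -> (0 < u)%R ->
    S0 (f + g)%R u <= Ca%:E * (S0 f u + S0 g u).
  move=> Xf Xg u0; have Xfg := (Ha 1%R _ _ ltr01 Xf Xg).1.
  apply: split_norm_add; [exact: wb0|exact: ww0|exact: (qk _ Xfg).1|exact: (qk _ Xf).1|
    exact: (qk _ Xg).1|exact: Ca0|exact: u0|move=> s s0].
  have [_] := Ha s f g s0 Xf Xg.
  by rewrite !(kfunE cX)// -EFinD -EFinM lee_fin.
have S1_add f g u : sum_space X0 X1 f -> sum_space X0 X1 g -> (0 < u)%R ->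
    S1 (f + g)%R u <= Ca%:E * (S1 f u + S1 g u).
  move=> Xf Xg u0; have Xfg := (Ha 1%R _ _ ltr01 Xf Xg).1.
  apply: split_norm_add; [exact: wb1|exact: ww1|exact: (qk _ Xfg).1|exact: (qk _ Xf).1|
    exact: (qk _ Xg).1|exact: Ca0|exact: u0|move=> s s0].
  have [_] := Ha s f g s0 Xf Xg.
  by rewrite !(kfunE cX)// -EFinD -EFinM lee_fin.
have S0_le f u : sum_space X0 X1 f -> (0 < u)%R -> S0 f u <= 2%:E * N0 f.
  move=> Xf u0.
  exact: (@split_norm_le_outer _ E0 F0 false _ _ _ _ _ wb0 ww0 (qk _ Xf).1 u0 (B0E u u0)).
have S1_le f u : sum_space X0 X1 f -> (0 < u)%R -> S1 f u <= 2%:E * N1 f.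
  move=> Xf u0.
  exact: (@split_norm_le_outer _ E1 F1 true _ _ _ _ _ wb1 ww1 (qk _ Xf).1 u0 (B1E u u0)).
have [qX0 qX1] : quasi_banach X0 /\ quasi_banach X1 by case: cX => _ [? _] [? _].
have XD f g : sum_space X0 X1 f -> sum_space X0 X1 g -> sum_space X0 X1 (f + g)%R.
  by move=> Xf Xg; have [] := Ha 1%R _ _ ltr01 Xf Xg.
(* The conclusion follows from these estimates alone, whatever the norms are. *)
clear Ha fb0 fb1 B0E B1E B0p B1p rhoE.
clearbody S0 S1 N0 N1 rhs rho YL YR.
pose c := (U0 + U1 + Ca * (2 + M0 + M1))%R.
have c0 : (0 < c)%R by rewrite !(addr_gt0, mulr_gt0).
exists c => [//|f u Yf u0].
have Xf : sum_space X0 X1 f.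
  by have [g0 [g1 [/YLP[Xg0 _] /YRP[Xg1 _] ->]]] := Yf; exact: XD.
have ru := rho0 u u0; have ru' := ltW ru.
have S0f := S0_ge0 f u Xf u0; have S1f := S1_ge0 f u Xf u0.
have rS1 : 0 <= (rho u)%:E * S1 f u by rewrite mule_ge0 ?lee_fin.
rewrite rhsE//; split.
- have [f0 [f1 [cf0 cf1 fE near far]]] := Hd u f u0 Xf.
  have Xf0 : sum_space X0 X1 f0.
    by exists f0, 0%R; rewrite addr0; split; [|exact: qb_0|].
  have Xf1 : sum_space X0 X1 f1.
    by exists 0%R, f1; rewrite add0r; split; [exact: qb_0| |].
  have n0 : N0 f0 <= U0%:E * S0 f u.
    apply: HU0 => // s s0; rewrite in_idir.
      by move=> /andP[_ su]; have [] := near s s0 (ltW su).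
    by move=> us; have [] := far s s0 (ltW us); rewrite powRr0 mul1r.
  have n1 : N1 f1 <= U1%:E * S1 f u.
    apply: HU1 => // s s0; rewrite in_idir.
      by move=> us; have [] := far s s0 (ltW us).
    move=> /andP[_ su]; have [_] := near s s0 (ltW su).
    rewrite powRr1 ?divr_ge0 ?(ltW s0) ?(ltW u0)//.
    by rewrite [(s / u * _)%R]mulrAC -[(s * _ / u)%R]mulrA.
  have n01 : N0 f0 + (rho u)%:E * N1 f1 <= c%:E * (S0 f u + (rho u)%:E * S1 f u).
    rewrite ge0_muleDr//; apply: leeD.
      apply: (le_trans n0); apply: lee_wpmul2r => //.
      by rewrite lee_fin /c -addrA lerDl !(addr_ge0, mulr_ge0)// ltW.
    apply: (@le_trans _ _ ((rho u)%:E * (U1%:E * S1 f u))).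
      by apply: lee_wpmul2l; rewrite ?lee_fin.
    rewrite muleCA; apply: lee_wpmul2r => //.
    by rewrite lee_fin /c -addrA addrCA lerDl !(addr_ge0, mulr_ge0)// ltW.
  (* The decomposition is admissible only if the norms of its parts are finite,
     which is known when the right-hand side is. *)
  have [fin|] := ltP (S0 f u + (rho u)%:E * S1 f u) +oo; last first.
    by rewrite leye_eq => /eqP ->; rewrite gt0_muley ?lte_fin// leey.
  have N0p := N0_ge0 f0 Xf0; have N1p := N1_ge0 f1 Xf1.
  have fin01 : N0 f0 + (rho u)%:E * N1 f1 < +oo.
    by apply: (le_lt_trans n01); rewrite lte_mul_pinfty ?lee_fin ?(ltW c0).
  have fin0 : N0 f0 < +oo.
    by apply: le_lt_trans fin01; rewrite leeDl// mule_ge0 ?lee_fin.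
  have fin1 : N1 f1 < +oo.
    have : (rho u)%:E * N1 f1 < +oo by apply: le_lt_trans fin01; rewrite leeDr.
    by move: N1p; case: (N1 f1) => [r _ _|_|//]; rewrite ?ltry// gt0_muley ?lte_fin.
  apply: le_trans n01; apply: ereal_inf_lbound; exists f0, f1; split.
  + exact/YLP.
  + exact/YRP.
  + exact: fE.
  + by rewrite N0E// N1E.
rewrite -lee_pdivrMl//; apply/ereal_infP => _ [g0 [g1 [/YLP[Xg0 fin0] /YRP[Xg1 fin1] fE ->]]].
rewrite lee_pdivrMl// N0E// N1E//.
have [n0 n0p N0r] : exists2 y, (0 <= y)%R & N0 g0 = y%:E.
  by have := N0_ge0 g0 Xg0; case: (N0 g0) fin0 => // y _ y0; exists y.
have [n1 n1p N1r] : exists2 y, (0 <= y)%R & N1 g1 = y%:E.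
  by have := N1_ge0 g1 Xg1; case: (N1 g1) fin1 => // y _ y0; exists y.
have fin_le (x : \bar R) (r : R) : 0 <= x -> x <= r%:E -> exists2 y, x = y%:E & (y <= r)%R.
  by case: x => // y _ yr; exists y.
have := S0_le g0 u Xg0 u0; rewrite N0r -EFinM => /(fin_le _ _ (S0_ge0 g0 u Xg0 u0))[s00 E00 l00].
have := HM0 g1 u Xg1 u0; rewrite N1r -EFinM => /(fin_le _ _ (S0_ge0 g1 u Xg1 u0))[s01 E01 l01].
have := S1_le g1 u Xg1 u0; rewrite N1r -EFinM => /(fin_le _ _ (S1_ge0 g1 u Xg1 u0))[s11 E11 l11].
have := HM1 g0 u Xg0 u0; rewrite N0r -EFinM muleC -lee_pdivlMr//.
rewrite -EFinM => /(fin_le _ _ (S1_ge0 g0 u Xg0 u0))[s10 E10]; rewrite ler_pdivlMr// => l10.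
have := S0_add _ _ u Xg0 Xg1 u0; rewrite -fE E00 E01 -EFinD -EFinM => h0.
have := S1_add _ _ u Xg0 Xg1 u0; rewrite -fE E10 E11 -EFinD -EFinM => h1.
have [t0 -> l0] := fin_le _ _ S0f h0; have [t1 -> l1] := fin_le _ _ S1f h1.
rewrite -!EFinM -!EFinD lee_fin.
have l1' := ler_wpM2l ru' l1.
have l11' := ler_wpM2l ru' l11.
have rn1 : (0 <= rho u * n1)%R by exact: mulr_ge0.
have big : (s00 + s01 + (s10 * rho u + rho u * s11) <=
    (2 + M0 + M1) * (n0 + rho u * n1))%R.
  have q0 := mulr_ge0 (ltW M0_gt0) n0p; have q1 := mulr_ge0 (ltW M1_gt0) rn1.
  lra.
have cn : (Ca * (2 + M0 + M1) * (n0 + rho u * n1) <= c * (n0 + rho u * n1))%R.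
  by rewrite ler_wpM2r ?addr_ge0// /c lerDr addr_ge0// ltW.
apply: le_trans cn; rewrite -mulrA.
apply: le_trans (ler_wpM2l (ltW Ca0) big).
apply: le_trans (lerD l0 l1') _.
by rewrite le_eqVlt; apply/orP; left; apply/eqP; ring.
Qed.
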